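(* Let $M=SU(2)^{\times n}$ with $n\in\mathbb{N}$ fixed, and let $\mathcal{S}$ be either $C^\infty(M)$ or the space $\mathcal{S}_G$ of gauge invariant smooth functions on $M$. Let $(U_k)_{k\in\mathbb{N}}$ be a contracting sequence of open sets around the identity $\mathbf{1}\in M$, such that $U_{k+1}\subset U_k$ for all $k$ and $\bigcap_{k\in\mathbb{N}}U_k=\{\mathbf{1}\}$. Let $\omega_k$ and $\omega_D^{\mathbf{1}}$ be the states on the Weyl algebra $\mathfrak{A}(\mathcal{S})$ given by $$\omega_k(W_{(f)})=\omega_F(W_{(f)})\,e^{i\sqrt2\,\operatorname{Re}\left[\frac{1}{|U_k|}\int_{U_k}f(x)\,\mathrm{d}x\right]},\qquad \omega_D^{\mathbf{1}}(W_{(f)})=\omega_F(W_{(f)})\,e^{i\sqrt2\,\operatorname{Re}f(\mathbf{1})}\qquad(f\in\mathcal{S}).$$ Then for every $k$ the state $\omega_k$ is equivalent to the Fock state $\omega_F$ (their GNS representations are unitarily equivalent), whereas the limit state $\omega_D^{\mathbf{1}}$ is inequivalent to the Fock state $\omega_F$.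
   Context: Let $G=SU(2)$, $M=G^{\times n}$ with normalized Haar measure $\mathrm{d}x$, $|U|=\int_U\mathrm{d}x$, and $(f,g)_{L^2}=\int_M \overline{f(x)}\,g(x)\,\mathrm{d}x$, with norm $\|\cdot\|_{L^2}$. For $h\in G$ put $D_h=(h,\dots,h)\in M$. $\mathcal{S}_G$ is the space of smooth functions $f:M\to\mathbb{C}$ with $f(xD_h)=f(x)$ for all $x\in M$, $h\in G$. The space $\mathcal{S}$ is regarded as a real vector space with the symplectic form $\mathfrak{s}(f,g)=\operatorname{Im}(f,g)_{L^2}$. The Weyl algebra $\mathfrak{A}(\mathcal{S})$ is the $C^\star$-algebra generated by linearly independent elements $W_{(f)}$, $f\in\mathcal{S}$, with $W_{(f)}W_{(g)}=e^{-\frac{i}{2}\mathfrak{s}(f,g)}W_{(f+g)}$ and $W_{(f)}^\star=W_{(-f)}$. It is obtained by completing the linear span of the $W_{(f)}$ first in the $\ell^1$-norm $\|\sum_i c_iW_{(f_i)}\|_1=\sum_i|c_i|$ (distinct $f_i$), giving a Banach $\star$-algebra, and then in the $C^\star$-norm $\|A\|_\star=\sup_\pi\|\pi(A)\|$, the supremum being over all non-degenerate irreducible $\star$-representations $\pi$ of this Banach $\star$-algebra on Hilbert spaces. The Fock state $\omega_F$ is the state on $\mathfrak{A}(\mathcal{S})$ determined by $\omega_F(W_{(f)})=e^{-\frac14\|f\|_{L^2}^2}$. All states are given on Weyl elements and extended to $\mathfrak{A}(\mathcal{S})$ by linearity.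
   Formalization: Inequivalence of the limit state is claimed only for n ≥ 1, and for n ≥ 2 when S is the gauge invariant space: for n = 1 gauge invariant functions are constant, and for n = 0 M is a point, so there the limit state equals every ω_k and is equivalent to the Fock state. *)

(* Defs.v *)
From HB Require Import structures.
From mathcomp Require Import all_boot all_order all_algebra.
From mathcomp Require Import all_classical all_reals all_analysis.
From mathcomp Require Import spectral complex.

Set Implicit Arguments.
Unset Strict Implicit.
Unset Printing Implicit Defensive.

Import Order.TTheory GRing.Theory Num.Theory numFieldNormedType.Exports.

Local Open Scope ring_scope.
Local Open Scope classical_set_scope.

Record SU2 (R : realType) := MkSU2 {
  su2mx :> 'M[R[i]]_2;
  su2P : (su2mx \is unitarymx) && (\det su2mx == 1) }.

HB.instance Definition _ (R : realType) := [isSub for @su2mx R].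
HB.instance Definition _ (R : realType) := [Choice of SU2 R by <:].

Section SU2_group.
Context {R : realType}.

Lemma SU2_one_subproof :
  ((1%:M : 'M[R[i]]_2) \is unitarymx) && (\det (1%:M : 'M[R[i]]_2) == 1).
Proof.
by apply/andP; split; [apply/unitarymxP; rewrite mul1mx trmx1 map_mx1 |
  rewrite det1].
Qed.
Definition SU2_one : SU2 R := MkSU2 SU2_one_subproof.

Lemma SU2_mul_subproof (g h : SU2 R) :
  ((g *m h) \is unitarymx) && (\det (g *m h) == 1).
Proof.
case: g h => [g /andP[gu /eqP g1]] [h /andP[hu /eqP h1]] /=.
by rewrite mul_unitarymx //= det_mulmx g1 h1 mulr1.
Qed.
Definition SU2_mul (g h : SU2 R) : SU2 R := MkSU2 (SU2_mul_subproof g h).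

End SU2_group.

Definition SU2n (R : realType) (n : nat) : Type := {ffun 'I_n -> SU2 R}.

HB.instance Definition _ R n := Choice.on (SU2n R n).

Section SU2n_group.
Context {R : realType} {n : nat}.

Definition SU2n_one : SU2n R n := [ffun=> SU2_one].
Definition SU2n_mul (x y : SU2n R n) : SU2n R n :=
  [ffun i => SU2_mul (x i) (y i)].
Definition SU2n_diag (h : SU2 R) : SU2n R n := [ffun=> h].

(* The i-th row lists the real and imaginary parts of the entries of x i. *)
Definition SU2n_coord (x : SU2n R n) : 'M[R]_(n, 2 * 2 + 2 * 2) :=
  \matrix_(i < n)
    row_mx (mxvec (map_mx (@complex.Re R) (x i)))
           (mxvec (map_mx (@complex.Im R) (x i))).

End SU2n_group.

HB.instance Definition _ R n := isPointed.Build (SU2n R n) SU2n_one.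
HB.instance Definition _ R n :=
  Topological.copy (SU2n R n) (initial_topology (@SU2n_coord R n)).
HB.instance Definition _ R n :=
  Measurable.copy (SU2n R n) (g_sigma_algebraType (@open (SU2n R n))).

(* On the compact group M a left-invariant probability is the normalized Haar
   measure. *)
Definition is_haar (R : realType) (n : nat) (mu : probability (SU2n R n) R) :=
  forall (x : SU2n R n) (A : set (SU2n R n)), measurable A ->
    mu [set SU2n_mul x y | y in A] = mu A.

(* On a finite-dimensional E this is C^k: all iterated directional derivatives
   up to order k exist everywhere and are continuous. *)
Fixpoint is_Ck (R : realType) (E : normedModType R) (k : nat) (F : E -> R)
    : Prop :=
  continuous F /\
  (if k is k'.+1 then
     forall v, (forall x, derivable F x v) /\ is_Ck k' (fun x => 'D_v F x)
   else True).

(* M is an embedded submanifold of the space of coordinates: a function on M is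
   smooth when it extends locally to a smooth function of the coordinates. *)
Definition smooth_fun (R : realType) (n : nat) (g : SU2n R n -> R) : Prop :=
  forall x : SU2n R n, exists F : 'M[R]_(n, 2 * 2 + 2 * 2) -> R,
    (forall k, is_Ck k F) /\ \forall y \near x, g y = F (SU2n_coord y).

Section smooth_closed.
Context {R : realType}.

Lemma is_Ck_cst (E : normedModType R) k (c : R) : is_Ck k (fun _ : E => c).
Proof.
elim: k c => [|k IH] c /=; split=> //; try by move=> x; exact: cvg_cst.
move=> v; split; first by move=> x; exact: derivable_cst.
suff -> : (fun x => 'D_v (fun _ : E => c) x) = (fun _ : E => 0) by exact: IH.
by apply/funext => x; rewrite derive_cst.
Qed.

Lemma is_Ck_lin (E : normedModType R) k (a : R) (F G : E -> R) :
  is_Ck k F -> is_Ck k G -> is_Ck k (fun x => a * F x + G x).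
Proof.
have cont F' G' : continuous F' -> continuous G' ->
    continuous (fun x : E => a * F' x + G' x : R).
  move=> cF cG x; apply: cvgD; last exact: cG.
  by apply: cvgM; [exact: cvg_cst|exact: cF].
elim: k F G => [|k IH] F G /= [cF dF] [cG dG]; split=> //; try exact: cont.
move=> v; have [dFv kF] := dF v; have [dGv kG] := dG v.
split=> [x|]; first by apply: derivableD; [exact: derivableZ|].
suff -> : (fun x => 'D_v (fun x => a * F x + G x) x) =
          (fun x => a * 'D_v F x + 'D_v G x) by exact: IH.
apply/funext => x; rewrite (_ : (fun x => _) = a \*: F + G) //.
by rewrite deriveD ?deriveZ //; exact: derivableZ.
Qed.

Lemma smooth_fun_cst n (c : R) : smooth_fun (fun _ : SU2n R n => c).
Proof.
by move=> x; exists (fun=> c); split=> [k|]; [exact: is_Ck_cst|by near=> y].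
Unshelve. all: by end_near.
Qed.

Lemma smooth_fun_lin n (a : R) (f g : SU2n R n -> R) :
  smooth_fun f -> smooth_fun g -> smooth_fun (fun x => a * f x + g x).
Proof.
move=> sf sg x; have [F [kF fF]] := sf x; have [G [kG gG]] := sg x.
exists (fun y => a * F y + G y); split=> [k|]; first exact: is_Ck_lin.
by near=> y; rewrite (near fF y) ?(near gG y).
Unshelve. all: by end_near.
Qed.

End smooth_closed.

(* For n = 1 the only gauge-invariant functions are the constants. *)
Variant field_space := all_smooth | gauge_invariant.

(* Rcomplex R is R[i] seen as a real vector space. *)
Definition smooth_fields (R : realType) (n : nat) (S : field_space) :
    {pred SU2n R n -> Rcomplex R} := fun f =>
  `[< [/\ smooth_fun (fun x => complex.Re (f x)),
          smooth_fun (fun x => complex.Im (f x)) &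
          if S is gauge_invariant then
            forall x h, f (SU2n_mul x (SU2n_diag h)) = f x
          else True] >].

Lemma smooth_fields_submod R n S : submod_closed (@smooth_fields R n S).
Proof.
split; first by apply/asboolP; split; [exact: smooth_fun_cst..|case: S].
move=> a f g /asboolP[f1 f2 fS] /asboolP[g1 g2 gS]; apply/asboolP.
have E x : (a *: f + g) x = a *: (f x : Rcomplex R) + g x by [].
split.
- rewrite (_ : (fun x => _) = fun x => a * complex.Re (f x) + complex.Re (g x)).
    exact: smooth_fun_lin.
  by apply/funext => x; rewrite E; case: (f x) (g x) => [? ?] [? ?].
- rewrite (_ : (fun x => _) = fun x => a * complex.Im (f x) + complex.Im (g x)).
    exact: smooth_fun_lin.
  by apply/funext => x; rewrite E; case: (f x) (g x) => [? ?] [? ?].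
- by case: S fS gS => // fS gS x h; rewrite !E fS gS.
Qed.

HB.instance Definition _ (R : realType) n S := GRing.isSubmodClosed.Build R
  (SU2n R n -> Rcomplex R) (@smooth_fields R n S) (@smooth_fields_submod R n S).

Record smooth_field (R : realType) (n : nat) (S : field_space) := MkField {
  field_val :> SU2n R n -> Rcomplex R;
  fieldP : field_val \in @smooth_fields R n S }.

HB.instance Definition _ (R : realType) n S := [isSub for @field_val R n S].
HB.instance Definition _ (R : realType) n S := [Choice of smooth_field R n S by <:].
HB.instance Definition _ (R : realType) n S := [SubChoice_isSubLmodule of smooth_field R n S by <:].

Definition Cintegral (R : realType) (n : nat) (mu : probability (SU2n R n) R)
    (U : set (SU2n R n)) (f : SU2n R n -> R[i]) : R[i] :=
  ((\int[mu]_(x in U) complex.Re (f x)) +i*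
   (\int[mu]_(x in U) complex.Im (f x)))%C.

Section L2.
Context {R : realType} {n : nat} {S : field_space}.
Variable mu : probability (SU2n R n) R.
Implicit Types f g : smooth_field R n S.

Definition L2inner f g : R[i] :=
  Cintegral mu setT (fun x => (f x : R[i])^* * (g x : R[i])).
Definition L2norm f : R := Num.sqrt (complex.Re (L2inner f f)).
Definition L2symp f g : R := complex.Im (L2inner f g).

Definition Cmean (U : set (SU2n R n)) f : R[i] :=
  ((fine (mu U))^-1)%:C%C * Cintegral mu U f.

End L2.

Definition expi (R : realType) (t : R) : R[i] := (cos t +i* sin t)%C.

Definition linear_span (K : numFieldType) (V : lmodType K) (X : set V) : set V :=
  [set v | exists (m : nat) (c : 'I_m -> K) (x : 'I_m -> V),
     (forall i, X (x i)) /\ v = \sum_(i < m) c i *: x i].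

Record banach_star (R : realType) := BanachStar {
  bs_sort :> completeNormedModType R[i];
  bs_mul : bs_sort -> bs_sort -> bs_sort;
  bs_one : bs_sort;
  bs_star : bs_sort -> bs_sort;
  bs_mulA : forall a b c, bs_mul a (bs_mul b c) = bs_mul (bs_mul a b) c;
  bs_mul1l : forall a, bs_mul bs_one a = a;
  bs_mul1r : forall a, bs_mul a bs_one = a;
  bs_mull : forall a, linear (bs_mul a);
  bs_mulr : forall b, linear (bs_mul^~ b);
  bs_normM : forall a b, `|bs_mul a b| <= `|a| * `|b|;
  bs_starK : forall a, bs_star (bs_star a) = a;
  bs_starL : forall (c : R[i]) a b,
    bs_star (c *: a + b) = c^* *: bs_star a + bs_star b;
  bs_starM : forall a b, bs_star (bs_mul a b) = bs_mul (bs_star b) (bs_star a);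
  bs_norm_star : forall a, `|bs_star a| = `|a| }.

Definition is_cstar (R : realType) (A : banach_star R) : Prop :=
  forall a : A, `|bs_mul (bs_star a) a| = `|a| ^+ 2.

(* The inner product is conjugate-linear in its first argument. *)
Record hilbert (R : realType) := Hilbert {
  h_sort :> completeNormedModType R[i];
  h_inner : h_sort -> h_sort -> R[i];
  h_innerL : forall x (c : R[i]) y z,
    h_inner x (c *: y + z) = c * h_inner x y + h_inner x z;
  h_innerC : forall x y, h_inner y x = (h_inner x y)^*;
  h_inner_norm : forall x, h_inner x x = `|x| ^+ 2 }.

Record star_rep (R : realType) (A : banach_star R) (H : hilbert R) := StarRep {
  rep_op :> A -> H -> H;
  rep_linearl : forall x, linear (rep_op^~ x);
  rep_linear : forall a, linear (rep_op a);
  rep_bounded : forall a, exists c : R[i], forall x, `|rep_op a x| <= c * `|x|;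
  rep_mul : forall a b x, rep_op (bs_mul a b) x = rep_op a (rep_op b x);
  rep_star : forall a x y,
    h_inner (rep_op (bs_star a) x) y = h_inner x (rep_op a y) }.

Section representations.
Context {R : realType} {A : banach_star R}.

Definition nondegenerate_rep (H : hilbert R) (p : star_rep A H) : Prop :=
  closure (linear_span [set p a x | a in setT & x in setT]) = setT.

Definition irreducible_rep (H : hilbert R) (p : star_rep A H) : Prop :=
  (exists x : H, x != 0) /\
  forall L : set H, closed L -> linear_span L = L ->
    (forall a x, L x -> L (p a x)) -> L = [set 0] \/ L = setT.

Definition op_norm (H : hilbert R) (T : H -> H) : R :=
  sup [set r | exists2 x : H, `|x| <= 1 & r = complex.Re `|T x| ].

Definition unitarily_equivalent (H1 H2 : hilbert R)
    (p1 : star_rep A H1) (p2 : star_rep A H2) : Prop :=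
  exists u : H1 -> H2, [/\ linear u, bijective u,
    forall x y, h_inner (u x) (u y) = h_inner x y &
    forall a x, u (p1 a x) = p2 a (u x)].

Definition cstar_norm (a : A) : R :=
  sup [set r | exists (H : hilbert R) (p : star_rep A H),
         [/\ nondegenerate_rep p, irreducible_rep p & r = op_norm (p a)] ].

(* The last two fields say that a state has norm one. *)
Record state := State {
  state_val :> A -> R[i];
  state_linear : forall (c : R[i]) a b,
    state_val (c *: a + b) = c * state_val a + state_val b;
  state_pos : forall a, 0 <= state_val (bs_mul (bs_star a) a);
  state_one : state_val (bs_one A) = 1;
  state_bounded : forall a, `|state_val a| <= `|a| }.

Record gns (w : state) := Gns {
  gns_space : hilbert R;
  gns_rep : star_rep A gns_space;
  gns_vec : gns_space;
  gns_state : forall a, w a = h_inner gns_vec (gns_rep a gns_vec);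
  gns_cyclic : closure [set gns_rep a gns_vec | a in setT] = setT }.

(* GNS triples exist and are unique up to unitary equivalence. *)
Definition equivalent_states (w1 w2 : state) : Prop :=
  exists (G1 : gns w1) (G2 : gns w2),
    unitarily_equivalent (gns_rep G1) (gns_rep G2).

End representations.

Arguments state {R} A.

Section weyl.
Context {R : realType} {V : lmodType R}.
Variable s : V -> V -> R.

Definition weyl_relations (A : banach_star R) (W : V -> A) : Prop :=
  (forall f g, bs_mul (W f) (W g) = expi (- (s f g / 2)) *: W (f + g)) /\
  (forall f, bs_star (W f) = W (- f)).

(* The completion of the span of the W_f in the l^1-norm. *)
Record weyl_l1 := WeylL1 {
  wl_alg :> banach_star R;
  wl_W : V -> wl_alg;
  wl_relations : weyl_relations wl_W;
  wl_norm : forall (m : nat) (c : 'I_m -> R[i]) (f : 'I_m -> V), injective f ->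
    `|\sum_(i < m) c i *: wl_W (f i)| = \sum_(i < m) `|c i|;
  wl_dense : closure (linear_span (range wl_W)) = setT }.

(* The completion of the l^1-algebra in the C*-norm, wa_map being the canonical
   map; both completions are characterized up to isomorphism. *)
Record weyl_algebra := WeylAlgebra {
  wa_l1 : weyl_l1;
  wa_alg :> banach_star R;
  wa_cstar : is_cstar wa_alg;
  wa_map : wa_l1 -> wa_alg;
  wa_linear : linear wa_map;
  wa_mul : forall a b, wa_map (bs_mul a b) = bs_mul (wa_map a) (wa_map b);
  wa_star : forall a, wa_map (bs_star a) = bs_star (wa_map a);
  wa_norm : forall a, complex.Re `|wa_map a| = cstar_norm a;
  wa_dense : closure (range wa_map) = setT;
  wa_free : forall (m : nat) (c : 'I_m -> R[i]) (f : 'I_m -> V), injective f ->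
    \sum_(i < m) c i *: wa_map (wl_W wa_l1 (f i)) = 0 -> forall i, c i = 0 }.

Definition weyl (A : weyl_algebra) (f : V) : A := wa_map (wl_W (wa_l1 A) f).

End weyl.

Arguments weyl {R V s A} f.

Definition fock_value (R : realType) (n : nat) (S : field_space)
    (mu : probability (SU2n R n) R) (f : smooth_field R n S) : R[i] :=
  (expR (- (L2norm mu f ^+ 2 / 4)))%:C%C.

(* Main.v *)
(* Part 1. The functional f |-> sqrt 2 Re (mean of f over U_k) is bounded for the
   L^2-norm, hence by a Riesz argument it is the limit of L2symp (h_j, -) for
   some L^2-Cauchy sequence of fields h_j. In the GNS space of omega_F the
   vectors W(h_j) Omega then converge to a cyclic vector whose vector state is
   omega_k, so that both states have the same GNS representation.

   Part 2. The set of x whose first component is 1 (in the gauge-invariant case: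
   whose first two components agree) is Haar-null, so there are fields f_j with
   |f_j| -> 0 in L^2 and exp(i sqrt 2 Re f_j(1)) = -1. In the Fock representation
   W(f_j) -> 1 strongly, so a vector Psi with vector state omega_D would satisfy
   <Psi, Psi> = lim omega_D(W(f_j)) = -1.

   Existence of GNS triples and continuity of all maps involved rest on the
   square root of 1 - h for a self-adjoint h with |h| < 1 in a Banach
   star-algebra. *)

From HB Require Import structures.
Require Import Defs.
From mathcomp Require Import all_boot all_order all_algebra.
From mathcomp Require Import all_classical all_reals all_analysis.
From mathcomp Require Import complex ring lra.

Set Implicit Arguments.
Unset Strict Implicit.
Unset Printing Implicit Defensive.

Import Order.TTheory GRing.Theory Num.Theory numFieldNormedType.Exports.

Local Open Scope ring_scope.
Local Open Scope classical_set_scope.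

(** * Real-valued norms and rates of convergence *)

(** Since W(-h) W(f) W(h) = exp(i s(h,f)) W(f), the vector W(h) Omega carries the Fock state times a
    phase real-linear in f. The phase of omega_k would come from an h proportional to i times the
    indicator function of U_k, which is not a smooth field. So the limit is taken among vectors of
    the GNS space, where it exists although no label h does. Evaluation at the identity, in
    contrast, is not L^2-continuous, and the fields f_j witness this; the phase -1 is chosen because
    it contradicts positivity of <Psi, Psi> at once. Identities are known on Weyl elements only.
    Carrying them to the whole algebra takes two density steps, through the l^1-norm and the
    C*-norm, and a norm bound for each. A star representation comes merely with some bound for each
    element and may be degenerate; its contractivity is extracted from the positivity of its vector
    functionals. *)

Section real_norm.
Context {R : realType} {V : normedZmodType R[i]}.
Implicit Types x y : V.

(* Norms over R[i] are R[i]-valued; nm takes values in R. *)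
Definition nm x : R := complex.Re `|x|.

Lemma nmE x : `|x| = (nm x)%:C%C.
Proof. by rewrite /nm RRe_real ?normr_real. Qed.

Lemma nm_ge0 x : 0 <= nm x.
Proof. by rewrite -ler0c -nmE. Qed.

Lemma nm0 : nm (0 : V) = 0.
Proof. by rewrite /nm normr0. Qed.

Lemma nmN x : nm (- x) = nm x.
Proof. by rewrite /nm normrN. Qed.

Lemma nmD x y : nm (x + y) <= nm x + nm y.
Proof. by have := ler_normD x y; rewrite !nmE -rmorphD lecR. Qed.

Lemma nmBC x y : nm (x - y) = nm (y - x).
Proof. by rewrite -opprB nmN. Qed.

Lemma nm_distD z x y : nm (x - y) <= nm (x - z) + nm (z - y).
Proof. by apply: le_trans (nmD _ _); rewrite addrA subrK. Qed.

Lemma nm_eq0 x : nm x = 0 -> x = 0.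
Proof. by move=> x0; apply/normr0_eq0; rewrite nmE x0. Qed.

Lemma nm_lt x (r : R) : (`|x| < r%:C%C) = (nm x < r).
Proof. by rewrite nmE ltcR. Qed.

Lemma nm_le x (r : R) : (`|x| <= r%:C%C) = (nm x <= r).
Proof. by rewrite nmE lecR. Qed.

End real_norm.

Section nm_complex.
Context {R : realType}.
Implicit Types z w : R[i].

Lemma nmM z w : nm (z * w) = nm z * nm w.
Proof. by apply/complexI; rewrite rmorphM -!nmE normrM. Qed.

Lemma nmJ z : nm (z^*) = nm z.
Proof. by apply/complexI; rewrite -!nmE norm_conjC. Qed.

Lemma conjCE z : z^* = (complex.Re z -i* complex.Im z)%C.
Proof. by case: z. Qed.

Lemma nm_real (r : R) : nm r%:C%C = `|r|.
Proof. by rewrite /nm normc_def /= expr0n addr0 sqrtr_sqr. Qed.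

Lemma nm_sqr z : nm z ^+ 2 = complex.Re z ^+ 2 + complex.Im z ^+ 2.
Proof. by apply/complexI; rewrite rmorphXn /= -nmE add_Re2_Im2. Qed.

Lemma nm_Re z : `|complex.Re z| <= nm z.
Proof. by rewrite -lecR -nmE normc_ge_Re. Qed.

Lemma nm_Im z : `|complex.Im z| <= nm z.
Proof.
rewrite -(@ler_pXn2r _ 2) ?nnegrE ?nm_ge0//.
by rewrite nm_sqr real_normK ?num_real// lerDr sqr_ge0.
Qed.

Lemma nm_ReIm z : nm z <= `|complex.Re z| + `|complex.Im z|.
Proof.
rewrite -(@ler_pXn2r _ 2) ?nnegrE ?nm_ge0 ?addr_ge0//.
rewrite nm_sqr sqrrD !real_normK ?num_real// -addrA lerD2l.
by rewrite lerDr mulrn_wge0// mulr_ge0.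
Qed.

End nm_complex.

Section limits.
Context {R : realType}.

Lemma cvg0_squeeze (e d : nat -> R) :
  d @ \oo --> 0 -> (forall n, 0 <= e n <= d n) -> e @ \oo --> 0.
Proof.
move=> d0 ed; apply: (squeeze_cvgr _ (cvg_cst 0) d0).
by near=> n; exact: ed.
Unshelve. all: by end_near.
Qed.

Lemma cvg0D (e d : nat -> R) :
  e @ \oo --> 0 -> d @ \oo --> 0 -> (fun n => e n + d n) @ \oo --> 0.
Proof. by move=> e0 d0; rewrite -[X in _ --> X]addr0; exact: cvgD. Qed.

Lemma cvg0Z (c : R) (e : nat -> R) :
  e @ \oo --> 0 -> (fun n => c * e n) @ \oo --> 0.
Proof. by move=> e0; rewrite -[X in _ --> X](mulr0 c); apply: cvgMr. Qed.

Lemma cvg0_le (e : nat -> R) (x y : R) :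
  e @ \oo --> 0 -> (forall n, x <= y + e n) -> x <= y.
Proof.
move=> e0 xy; have h : (fun n => y + e n) @ \oo --> y + 0.
  by apply: cvgD => //; exact: cvg_cst.
rewrite -[y]addr0 -(cvg_lim _ h)//; apply: limr_ge; first exact: cvgP h.
by near=> n; exact: xy.
Unshelve. all: by end_near.
Qed.

Lemma cvg0_inv : (fun n : nat => n.+1%:R^-1 : R) @ \oo --> 0.
Proof. exact: cvg_harmonic. Qed.

Lemma cvg0_ex (e : nat -> R) (d : R) :
  e @ \oo --> 0 -> 0 < d -> exists n, e n < d.
Proof.
move=> /cvgrPdist_lt /(_ d) e0 /e0 [N _ /(_ N (leqnn N))] /=.
rewrite sub0r normrN => h; exists N; exact: le_lt_trans (ler_norm _) h.
Qed.

(** With the Cauchy condition in the form [e n + e m], letting m tend to infinity gives the limit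
    with the same rate [e n]. All completeness arguments below carry such explicit rates. *)
Lemma cauchy_rate (x : nat -> R) (e : nat -> R) : e @ \oo --> 0 ->
  (forall n m, `|x n - x m| <= e n + e m) -> exists l, forall n, `|x n - l| <= e n.
Proof.
move=> e0 xe.
have cx : cvg (x @ \oo).
  apply/cauchy_cvgP; apply/cauchy_ballP => r r0; near_simpl.
  have r2 : 0 < r / 2 by rewrite divr_gt0.
  have /cvgrPdist_lt /(_ _ r2) [N _ eN] := e0.
  exists ([set n | N <= n], [set n | N <= n])%N; first by split; exists N.
  move=> [n m] [/= /eN]; rewrite sub0r normrN => en /eN.
  rewrite sub0r normrN => em.
  rewrite /ball /=; apply: le_lt_trans (xe _ _) _.
  move: (le_lt_trans (ler_norm _) en) (le_lt_trans (ler_norm _) em); lra.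
exists (lim (x @ \oo)) => n.
apply: (@cvg0_le (fun m => e m + `|x m - lim (x @ \oo)|)).
  apply: cvg0D => //.
  have /cvgrPdist_lt cx' := cx; apply/cvgrPdist_lt => r /cx' [N _ rN].
  by exists N => // k /rN /=; rewrite sub0r normrN normr_id distrC.
move=> m; apply: le_trans (ler_distD (x m) _ _) _.
by rewrite addrA lerD2r.
Qed.

Lemma ccauchy_rate (z : nat -> R[i]) (e : nat -> R) : e @ \oo --> 0 ->
  (forall n m, nm (z n - z m) <= e n + e m) ->
  exists l, forall n, nm (z n - l) <= e n.
Proof.
move=> e0 ze.
have [a ha] : exists a, forall n, `|complex.Re (z n) - a| <= e n.
  apply: cauchy_rate => // n m; apply: le_trans (ze n m).
  by apply: le_trans (nm_Re _); rewrite raddfB.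
have [b hb] : exists b, forall n, `|complex.Im (z n) - b| <= e n.
  apply: cauchy_rate => // n m; apply: le_trans (ze n m).
  by apply: le_trans (nm_Im _); rewrite raddfB.
exists (a +i* b)%C => n.
(* The two real limits only give [2 * e m] for the complex distance; m is free, so this loss
   disappears in the limit. *)
apply: (@cvg0_le (fun m => 3 * e m)); first exact: cvg0Z.
move=> m; apply: le_trans (nm_distD (z m) _ _) _.
have h : nm (z m - (a +i* b)%C) <= 2 * e m.
  apply: le_trans (nm_ReIm _) _; rewrite !raddfB /=.
  by have := ha m; have := hb m; lra.
by have := ze n m; lra.
Qed.

Lemma complete_rate (V : completeNormedModType R[i]) (x : nat -> V)
    (e : nat -> R) : e @ \oo --> 0 ->
  (forall n m, nm (x n - x m) <= e n + e m) ->
  exists l, forall n, nm (x n - l) <= e n.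
Proof.
move=> e0 xe.
have cx : cvg (x @ \oo).
  apply/cauchy_cvgP; apply/cauchy_ballP => r r0; near_simpl.
  have [r' rE] : exists r', r = r'%:C%C by apply/complex_realP; exact: gtr0_real.
  have r2 : 0 < r' / 2 by rewrite divr_gt0// -ltcR -rE.
  have /cvgrPdist_lt /(_ _ r2) [N _ eN] := e0.
  exists ([set n | N <= n], [set n | N <= n])%N; first by split; exists N.
  move=> [n m] [/= /eN]; rewrite sub0r normrN => en /eN.
  rewrite sub0r normrN => em.
  rewrite -ball_normE /= rE nm_lt; apply: le_lt_trans (xe _ _) _.
  move: (le_lt_trans (ler_norm _) en) (le_lt_trans (ler_norm _) em); lra.
exists (lim (x @ \oo)) => n.
apply: (@cvg0_le (fun m => e m + nm (x m - lim (x @ \oo)))).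
  apply: cvg0D => //.
  have /cvgrPdist_lt cx' := cx; apply/cvgrPdist_lt => r r0.
  have rc : 0 < r%:C%C :> R[i] by rewrite ltcR.
  have [N _ rN] := cx' _ rc; exists N => // k /rN /=.
  by rewrite nm_lt sub0r normrN ger0_norm ?nm_ge0// nmBC.
move=> m; apply: le_trans (nm_distD (x m) _ _) _.
by rewrite addrA lerD2r.
Qed.

Lemma closureP (V : normedModType R[i]) (X : set V) (a : V) :
  closure X a <-> forall e : R, 0 < e -> exists2 b, X b & nm (a - b) < e.
Proof.
split=> [cXa e e0|h].
  have /cXa [b [Xb]] : nbhs a (ball a (e%:C%C : R[i])).
    by apply: nbhsx_ballx; rewrite ltcR.
  by rewrite -ball_normE /= nm_lt; exists b.
move=> B /nbhs_ballP [r /= r0 rB].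
have [r' rE] : exists r', r = r'%:C%C by apply/complex_realP; exact: gtr0_real.
have [b Xb ab] : exists2 b, X b & nm (a - b) < r'.
  by apply: h; rewrite -ltcR -rE.
by exists b; split => //; apply: rB; rewrite -ball_normE /= rE nm_lt.
Qed.

End limits.

(** * Pre-Hilbert spaces and their completion *)

(** Evaluation at the minimum [t = - b / c]. The Cauchy-Schwarz inequalities below and the
    derivative estimate in [riesz_approx] rest on it. *)
Lemma discr_le {R : realType} (a b c : R) : 0 <= a -> 0 <= c ->
  (forall t, 0 <= a + 2 * t * b + t ^+ 2 * c) -> b ^+ 2 <= a * c.
Proof.
move=> a0 c0 h; have [c00|cN0] := eqVneq c 0.
  subst c; rewrite mulr0; have [->|bN0] := eqVneq b 0; first by rewrite expr0n.
  (* In the degenerate case the polynomial is affine, and this t gives it the value -1. *)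
  have := h (- (a + 1) / (2 * b)).
  rewrite (_ : a + _ + _ = -1) ?oppr_ge0 ?ler10//; by field.
have := h (- b / c); rewrite (_ : a + _ + _ = (a * c - b ^+ 2) / c); last by field.
by rewrite pmulr_lge0 ?invr_gt0 ?lt_def ?cN0// subr_ge0.
Qed.

(** Only semidefinite: the GNS form [w (a^* b)] may have null vectors, and the completion below
    sends them to 0. *)
Record prehilbert (R : realType) := PreHilbert {
  ph_sort :> lmodType R[i];
  ph_ip : ph_sort -> ph_sort -> R[i];
  ph_ipL : forall x (c : R[i]) y z,
    ph_ip x (c *: y + z) = c * ph_ip x y + ph_ip x z;
  ph_ipC : forall x y, ph_ip y x = (ph_ip x y)^*;
  ph_ip_ge0 : forall x, 0 <= ph_ip x x }.

Section prehilbert_theory.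
Context {R : realType} {P : prehilbert R}.
Implicit Types (x y z : P) (c : R[i]).
Local Notation ip := (@ph_ip R P).

Lemma ipDr x y z : ip x (y + z) = ip x y + ip x z.
Proof. by rewrite -[y in LHS]scale1r ph_ipL mul1r. Qed.

Lemma ip0r x : ip x 0 = 0.
Proof. by apply: (@addrI _ (ip x 0)); rewrite -ipDr !addr0. Qed.

Lemma ipZr x c y : ip x (c *: y) = c * ip x y.
Proof. by rewrite -[c *: y]addr0 ph_ipL ip0r addr0. Qed.

Lemma ipNr x y : ip x (- y) = - ip x y.
Proof. by rewrite -scaleN1r ipZr mulN1r. Qed.

Lemma ipBr x y z : ip x (y - z) = ip x y - ip x z.
Proof. by rewrite ipDr ipNr. Qed.

Lemma ipDl x y z : ip (x + y) z = ip x z + ip y z.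
Proof. by rewrite ph_ipC ipDr rmorphD /= -!ph_ipC. Qed.

Lemma ipNl x y : ip (- x) y = - ip x y.
Proof. by rewrite ph_ipC ipNr rmorphN /= -ph_ipC. Qed.

Lemma ipBl x y z : ip (x - y) z = ip x z - ip y z.
Proof. by rewrite ipDl ipNl. Qed.

Lemma ipZl c x y : ip (c *: x) y = c^* * ip x y.
Proof. by rewrite ph_ipC ipZr rmorphM /= -ph_ipC. Qed.

Lemma Re_ipC x y : complex.Re (ip y x) = complex.Re (ip x y).
Proof. by rewrite ph_ipC conjCE. Qed.

Definition pn x : R := Num.sqrt (complex.Re (ip x x)).

Lemma pn_ge0 x : 0 <= pn x. Proof. exact: sqrtr_ge0. Qed.

Lemma Re_ip_ge0 x : 0 <= complex.Re (ip x x).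
Proof. by have := ph_ip_ge0 x; rewrite lecE => /andP[]. Qed.

Lemma pn_sqr x : pn x ^+ 2 = complex.Re (ip x x).
Proof. by rewrite sqr_sqrtr ?Re_ip_ge0. Qed.

Lemma ip_self x : ip x x = (pn x ^+ 2)%:C%C.
Proof. by rewrite pn_sqr RRe_real ?ger0_real ?ph_ip_ge0. Qed.

Lemma pn_sqrD x y :
  pn (x + y) ^+ 2 = pn x ^+ 2 + 2 * complex.Re (ip x y) + pn y ^+ 2.
Proof. rewrite !pn_sqr ipDl !ipDr !raddfD /= (Re_ipC x y); ring. Qed.

Lemma pnZ c x : pn (c *: x) = nm c * pn x.
Proof.
apply/eqP; rewrite -(@eqrXn2 _ 2) ?pn_ge0 ?mulr_ge0 ?nm_ge0 ?pn_ge0//; apply/eqP.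
rewrite pn_sqr ipZr ipZl mulrA -normCK nmE -rmorphXn ip_self -rmorphM /=.
by rewrite exprMn.
Qed.

Lemma pnN x : pn (- x) = pn x.
Proof. by rewrite /pn ipNl ipNr opprK. Qed.

Lemma pn0 : pn 0 = 0.
Proof. by rewrite /pn ip0r sqrtr0. Qed.

Lemma Re_ip_le x y : complex.Re (ip x y) <= pn x * pn y.
Proof.
have h : complex.Re (ip x y) ^+ 2 <= pn x ^+ 2 * pn y ^+ 2.
  apply: discr_le => [||t]; rewrite ?sqr_ge0//.
  have := sqr_ge0 (pn (x + t%:C%C *: y)).
  rewrite pn_sqrD pnZ nm_real ipZr exprMn real_normK ?num_real//.
  by case: (ip x y) => a b /=; rewrite mul0r subr0 mulrA.
apply: le_trans (ler_norm _) _.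
by rewrite -(@ler_pXn2r _ 2) ?nnegrE ?mulr_ge0 ?pn_ge0// exprMn real_normK ?num_real.
Qed.

Lemma ip_le x y : nm (ip x y) <= pn x * pn y.
Proof.
(* Scaling x by [ip x y] makes the inner product the real number [nm (ip x y) ^+ 2], so the bound on
   real parts suffices. *)
have := Re_ip_le (ip x y *: x) y.
rewrite ipZl pnZ -normCKC nmE -rmorphXn /= -mulrA expr2.
have [->|z0] := eqVneq (nm (ip x y)) 0; first by rewrite mulr_ge0 ?pn_ge0.
have z_gt0 : 0 < nm (ip x y) by rewrite lt_def z0 nm_ge0.
by rewrite (ler_pM2l z_gt0).
Qed.

Lemma pnD x y : pn (x + y) <= pn x + pn y.
Proof.
rewrite -(@ler_pXn2r _ 2) ?nnegrE ?addr_ge0 ?pn_ge0// pn_sqrD sqrrD.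
by rewrite lerD2r lerD2l -[leRHS]mulr_natl ler_pM2l// Re_ip_le.
Qed.

Lemma ip_dist_le x y x' y' :
  nm (ip x y - ip x' y') <= pn (x - x') * pn y + pn x' * pn (y - y').
Proof.
rewrite (_ : _ - _ = ip (x - x') y + ip x' (y - y')); last first.
  by rewrite ipBl ipBr addrA subrK.
by apply: le_trans (nmD _ _) _; apply: lerD; exact: ip_le.
Qed.

End prehilbert_theory.

Lemma h_inner_ge0 {R : realType} (H : hilbert R) (x : H) : 0 <= h_inner x x.
Proof. by rewrite h_inner_norm exprn_ge0. Qed.

Definition hilbert_pre {R : realType} (H : hilbert R) : prehilbert R :=
  PreHilbert (@h_innerL R H) (@h_innerC R H) (@h_inner_ge0 R H).

Lemma pn_hilbert_pre {R : realType} (H : hilbert R) (x : hilbert_pre H) : pn x = nm (x : H).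
Proof.
by rewrite /pn /= h_inner_norm nmE -rmorphXn /= sqrtr_sqr ger0_norm ?nm_ge0.
Qed.

(** * Completion of a pre-Hilbert space inside its antidual *)

Section approximable.
Context {R : realType} (P : prehilbert R).

(** The closure of the functionals [u |-> <u, v>] in the dual norm. Antilinearity passes from the
    approximants to phi, see [cev_linearl]. *)
Definition approximable : {pred P -> R[i]^o} := fun phi =>
  `[< forall e : R, 0 < e ->
      exists v : P, forall u, nm ((phi u : R[i]) - ph_ip u v) <= e * pn u >].

Lemma approximable_submod : submod_closed approximable.
Proof.
split.
  apply/asboolP => e e0; exists 0 => u.
  by rewrite ip0r subrr nm0 mulr_ge0 ?pn_ge0// ltW.
move=> c f g /asboolP hf /asboolP hg; apply/asboolP => e e0.
have c0 : 0 < nm c + 1 by rewrite ltr_wpDl ?nm_ge0.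
have [v hv] := hf _ (divr_gt0 e0 (mulr_gt0 (ltr0Sn _ 1) c0)).
have [w hw] := hg _ (divr_gt0 e0 (ltr0Sn _ 1)).
exists (c *: v + w) => u.
have -> : ((c *: f + g) u : R[i]) - ph_ip u (c *: v + w) =
    c * ((f u : R[i]) - ph_ip u v) + ((g u : R[i]) - ph_ip u w).
  rewrite ph_ipL (_ : (c *: f + g) u = c * (f u : R[i]) + g u)//; ring.
apply: le_trans (nmD _ _) _; rewrite nmM.
have h1 : nm c * nm ((f u : R[i]) - ph_ip u v) <= e / 2 * pn u.
  apply: (@le_trans _ _ (nm c * (e / (2 * (nm c + 1)) * pn u))).
    by rewrite ler_wpM2l ?nm_ge0.
  rewrite mulrA ler_wpM2r ?pn_ge0//.
  rewrite (_ : _ * _ = e / 2 * (nm c / (nm c + 1))); last first.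
    by field; rewrite gt_eqF.
  rewrite ler_piMr ?divr_ge0 ?ltW// ltr_pdivrMr// mul1r ltrDl//.
by have := hw u; lra.
Qed.

HB.instance Definition _ := GRing.isSubmodClosed.Build R[i]
  (P -> R[i]^o) approximable approximable_submod.

(* The completion of P is realised inside its algebraic antidual, u |-> <u, v>
   being the image of v. *)
Record completion := MkCompletion {
  compl_val :> P -> R[i]^o;
  complP : compl_val \in approximable }.

HB.instance Definition _ := [isSub for compl_val].
HB.instance Definition _ := [Choice of completion by <:].
HB.instance Definition _ := [SubChoice_isSubLmodule of completion by <:].

End approximable.

Section completion_theory.
Context {R : realType} {P : prehilbert R}.
Implicit Types (f g h : completion P) (u : P) (c : R[i]).
Local Notation ip := (@ph_ip R P).

Definition cev f u : R[i] := f u.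

Lemma cevL c f g u : cev (c *: f + g) u = c * cev f u + cev g u.
Proof. by []. Qed.

Lemma cevB f g u : cev (f - g) u = cev f u - cev g u.
Proof. by []. Qed.

Lemma compl_ext f g : (forall u, cev f u = cev g u) -> f = g.
Proof. by move=> fg; apply/val_inj/funext. Qed.

Lemma complE f (e : R) : 0 < e ->
  exists v, forall u, nm (cev f u - ip u v) <= e * pn u.
Proof. by case: f => f /= /asboolP; exact. Qed.

Definition approx f (v : nat -> P) (e : nat -> R) :=
  [/\ e @ \oo --> 0, forall n, 0 <= e n &
      forall n u, nm (cev f u - ip u (v n)) <= e n * pn u].

Definition aseq f (n : nat) : P :=
  projT1 (cid (@complE f (n.+1%:R^-1) (harmonic_gt0 n))).

Lemma aseqP f : approx f (aseq f) (fun n => n.+1%:R^-1).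
Proof.
split; [exact: cvg0_inv|by move=> n; rewrite invr_ge0|].
by move=> n; rewrite /aseq; case: cid.
Qed.

(** Both sequences are tested at their own difference x: [|x|^2 = <x, v n> - <x, w m>], and each
    term is close to the value of f at x. *)
Lemma approx_dist f v w d e n m : approx f v d -> approx f w e ->
  pn (v n - w m) <= d n + e m.
Proof.
move=> [_ d0 hv] [_ e0 hw]; set x := v n - w m.
have [->|x0] := eqVneq (pn x) 0; first by rewrite addr_ge0.
have x_gt0 : 0 < pn x by rewrite lt_def x0 pn_ge0.
rewrite -(ler_pM2r x_gt0) -expr2 pn_sqr {2}/x ipBr.
apply: le_trans (le_trans (ler_norm _) (nm_Re _)) _.
rewrite mulrDl; apply: le_trans (nm_distD (cev f x) _ _) _.
by rewrite nmBC; apply: lerD; [exact: hv|exact: hw].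
Qed.

Lemma approx_le f v e n : approx f v e -> pn (v n) <= pn (v 0) + e 0 + e n.
Proof.
move=> fv; have := approx_dist n 0 fv fv; have := pnD (v n - v 0) (v 0).
by rewrite subrK; lra.
Qed.

Lemma approx_bound f v e : approx f v e -> exists2 B, 0 <= B &
  forall n, pn (v n) <= B.
Proof.
move=> fv; have [e0 ege0 _] := fv.
have /cvg_seq_bounded [M [_ hM]] : cvg (e @ \oo) by apply/cvg_ex; exists 0.
have M1 : M < `|M| + 1 by rewrite (le_lt_trans (ler_norm _)) ?ltrDl.
exists (pn (v 0) + e 0 + (`|M| + 1)); first by rewrite !addr_ge0 ?pn_ge0.
move=> n; apply: le_trans (approx_le n fv) _; rewrite lerD2l.
by apply: le_trans (ler_norm _) _; exact: (hM _ M1).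
Qed.

(** Uniformity in [v'] and [w'] is what makes [cip] usable: its laws can be checked on whichever
    sequences are convenient, such as constant ones for embedded vectors. *)
Lemma approx_ip f g v w d e : approx f v d -> approx g w e ->
  exists c, forall v' w' d' e', approx f v' d' -> approx g w' e' ->
    exists2 r : nat -> R, r @ \oo --> 0 & forall n, nm (ip (v' n) (w' n) - c) <= r n.
Proof.
move=> fv gw.
have key v' w' d' e' : approx f v' d' -> approx g w' e' ->
    exists r s : nat -> R, [/\ r @ \oo --> 0, s @ \oo --> 0,
      (forall n, 0 <= r n), (forall n, 0 <= s n) &
      forall n m, nm (ip (v' n) (w' n) - ip (v m) (w m)) <= r n + s m].
  move=> fv' gw'; have [B B0 hB] := approx_bound fv.
  have [B' B0' hB'] := approx_bound gw'.
  have [d0 dge0 _] := fv; have [d0' dge0' _] := fv'.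
  have [e0 ege0 _] := gw; have [e0' ege0' _] := gw'.
  exists (fun n => B' * d' n + B * e' n), (fun n => B' * d n + B * e n).
  split=> [||n|n|n m]; try by [apply: cvg0D; exact: cvg0Z |
    rewrite addr_ge0 ?mulr_ge0].
  apply: le_trans (ip_dist_le _ _ _ _) _.
  have h1 : pn (v' n - v m) * pn (w' n) <= (d' n + d m) * B'.
    by apply: ler_pM; rewrite ?pn_ge0//; exact: approx_dist fv' fv.
  have h2 : pn (v m) * pn (w' n - w m) <= B * (e' n + e m).
    by apply: ler_pM; rewrite ?pn_ge0//; exact: approx_dist gw' gw.
  by move: h1 h2; rewrite mulrDl mulrDr; lra.
have [r [s [r0 s0 rge0 sge0 rs]]] := key _ _ _ _ fv gw.
have [c hc] : exists c, forall n, nm (ip (v n) (w n) - c) <= (r n + s n).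
  apply: ccauchy_rate; first exact: cvg0D.
  move=> n m; apply: le_trans (rs n m) _.
  by have := rge0 m; have := sge0 n; lra.
exists c => v' w' d' e' fv' gw'.
have [r' [s' [r0' s0' _ _ rs']]] := key _ _ _ _ fv' gw'.
exists (fun n => r' n + s' n + (r n + s n)); first by do 2!apply: cvg0D.
move=> n; apply: le_trans (nm_distD (ip (v n) (w n)) _ _) _.
by apply: lerD.
Qed.
Definition cto (z : nat -> R[i]) c :=
  exists2 r : nat -> R, r @ \oo --> 0 & forall n, nm (z n - c) <= r n.

Lemma cto_unique (z : nat -> R[i]) a b : cto z a -> cto z b -> a = b.
Proof.
move=> [r r0 za] [s s0 zb]; apply/subr0_eq/nm_eq0/eqP.
rewrite eq_le nm_ge0 andbT; apply: (cvg0_le (cvg0D r0 s0)) => n; rewrite add0r.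
by apply: le_trans (nm_distD (z n) _ _) _; rewrite nmBC lerD.
Qed.

Lemma ctoL (c : R[i]) (z w : nat -> R[i]) a b : cto z a -> cto w b ->
  cto (fun n => c * z n + w n) (c * a + b).
Proof.
move=> [r r0 za] [s s0 wb]; exists (fun n => nm c * r n + s n).
  by apply: cvg0D => //; exact: cvg0Z.
move=> n; rewrite opprD addrACA -mulrBr; apply: le_trans (nmD _ _) _.
by rewrite nmM lerD// ler_wpM2l ?nm_ge0.
Qed.

Lemma ctoJ (z : nat -> R[i]) a : cto z a -> cto (fun n => (z n)^*) (a^*).
Proof. by move=> [r r0 za]; exists r => // n; rewrite -rmorphB nmJ. Qed.

Lemma cto_ext (z w : nat -> R[i]) a : (forall n, z n = w n) -> cto z a -> cto w a.
Proof. by move=> /funext ->. Qed.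

Lemma approxL c f g v w d e : approx f v d -> approx g w e ->
  approx (c *: f + g) (fun n => c *: v n + w n) (fun n => nm c * d n + e n).
Proof.
move=> [d0 dge0 hv] [e0 ege0 hw]; split=> [|n|n u].
- by apply: cvg0D => //; exact: cvg0Z.
- by rewrite addr_ge0 ?mulr_ge0 ?nm_ge0.
- rewrite cevL ph_ipL opprD addrACA -mulrBr mulrDl -mulrA.
  by apply: le_trans (nmD _ _) _; rewrite nmM lerD// ler_wpM2l ?nm_ge0.
Qed.

Lemma approx_cto f v e u : approx f v e -> cto (fun n => ip u (v n)) (cev f u).
Proof.
move=> [e0 _ h]; exists (fun n => pn u * e n); first exact: cvg0Z.
by move=> n; rewrite nmBC mulrC.
Qed.

Lemma cev_linearl f c u v : cev f (c *: u + v) = c^* * cev f u + cev f v.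
Proof.
have fv := aseqP f; apply: cto_unique (approx_cto _ fv) _.
apply: cto_ext (ctoL (c^*) (approx_cto u fv) (approx_cto v fv)) => n.
by rewrite ipDl ipZl.
Qed.

Definition cip f g : R[i] := projT1 (cid (approx_ip (aseqP f) (aseqP g))).

Lemma cip_cto f g v w d e : approx f v d -> approx g w e ->
  cto (fun n => ip (v n) (w n)) (cip f g).
Proof. by rewrite /cip; case: cid => c /= h; exact: h. Qed.

Lemma cipL f c g h : cip f (c *: g + h) = c * cip f g + cip f h.
Proof.
have fa := aseqP f; have ga := aseqP g; have ha := aseqP h.
apply: cto_unique (cip_cto fa (approxL c ga ha)) _.
apply: cto_ext (ctoL c (cip_cto fa ga) (cip_cto fa ha)) => n.
by rewrite ph_ipL.
Qed.

Lemma cipC f g : cip g f = (cip f g)^*.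
Proof.
apply: cto_unique (cip_cto (aseqP g) (aseqP f)) _.
apply: cto_ext (ctoJ (cip_cto (aseqP f) (aseqP g))) => n.
by rewrite -ph_ipC.
Qed.

Lemma cip_ge0 f : 0 <= cip f f.
Proof.
have fa := aseqP f; have [r r0 h] := cip_cto fa fa.
have Im0 : complex.Im (cip f f) = 0.
  have := cipC f f; rewrite conjCE; case: (cip f f) => a b /= [] *; lra.
rewrite lecE Im0 /=; apply/andP; split => //.
apply: (cvg0_le r0) => n; have := le_trans (nm_Re _) (h n).
by rewrite raddfB /=; have := Re_ip_ge0 (aseq f n); rewrite ler_norml; lra.
Qed.

Definition completion_pre : prehilbert R := PreHilbert cipL cipC cip_ge0.

Lemma embP u : (fun v => ip v u : R[i]^o) \in @approximable R P.
Proof.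
apply/asboolP => e e0; exists u => v.
by rewrite subrr nm0 mulr_ge0 ?pn_ge0// ltW.
Qed.
Definition emb u : completion P := MkCompletion (embP u).

Lemma cev_emb u v : cev (emb u) v = ip v u.
Proof. by []. Qed.

Lemma approx_emb u : approx (emb u) (fun=> u) (fun=> 0).
Proof.
split=> // [|n v]; first exact: cvg_cst.
by rewrite cev_emb subrr nm0 mul0r.
Qed.

Lemma cip_emb u f : cip (emb u) f = cev f u.
Proof.
by apply: cto_unique (cip_cto (approx_emb u) (aseqP f)) (approx_cto _ (aseqP f)).
Qed.

Lemma pn_emb u : pn (emb u : completion_pre) = pn u.
Proof. by rewrite /pn /= cip_emb cev_emb. Qed.

Lemma cev_le f u : nm (cev f u) <= pn (f : completion_pre) * pn u.
Proof.
by rewrite -cip_emb mulrC -(pn_emb u); exact: (@ip_le _ completion_pre).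
Qed.

(** Testing f on its own approximants gives [pn (aseq f n) <= c + e n], and the squares of these
    norms converge to that of the norm of f. *)
Lemma pn_completion_le f (c : R) : 0 <= c ->
  (forall u, nm (cev f u) <= c * pn u) -> pn (f : completion_pre) <= c.
Proof.
move=> c0 h; have fa := aseqP f; have [e0 ege0 he] := fa.
have [r r0 hr] := cip_cto fa fa.
rewrite -(@ler_pXn2r _ 2) ?nnegrE ?pn_ge0//.
pose e n : R := n.+1%:R^-1; pose d n := (2 * c) * e n + e n * e n + r n.
apply: (@cvg0_le _ d).
  apply: cvg0D => //; apply: cvg0D; first exact: cvg0Z.
  by rewrite -[X in _ --> X](mul0r 0); apply: cvgM.
move=> n; have h1 : pn (aseq f n) <= c + e n.
  have [->|x0] := eqVneq (pn (aseq f n)) 0; first by rewrite addr_ge0// ege0.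
  have x_gt0 : 0 < pn (aseq f n) by rewrite lt_def x0 pn_ge0.
  rewrite -(ler_pM2r x_gt0) -expr2 pn_sqr mulrDl.
  apply: le_trans (le_trans (ler_norm _) (nm_Re _)) _.
  rewrite -[X in nm X](subrK (cev f (aseq f n))) addrC.
  by apply: le_trans (nmD _ _) _; rewrite nmBC lerD.
have h2 : pn (aseq f n) ^+ 2 <= (c + e n) ^+ 2.
  by rewrite ler_pXn2r ?nnegrE ?pn_ge0 ?addr_ge0 ?ege0.
have := le_trans (nm_Re _) (hr n).
rewrite raddfB /= pn_sqr /= distrC => /(le_trans (ler_norm _)).
move: h2; rewrite pn_sqr /d sqrrD; lra.
Qed.

Lemma pn_completion_eq0 f : pn (f : completion_pre) = 0 -> f = 0.
Proof.
move=> f0; apply: compl_ext => u; apply/nm_eq0/eqP.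
rewrite eq_le nm_ge0 andbT; apply: le_trans (cev_le _ _) _.
by rewrite f0 mul0r.
Qed.

Lemma emb_dense f (e : R) : 0 < e -> exists u, pn (f - emb u : completion_pre) <= e.
Proof.
move=> e0; have [v hv] := complE f e0; exists v; apply: pn_completion_le; first exact: ltW.
by move=> u; rewrite cevB cev_emb.
Qed.

(** The limit is built pointwise, as a limit of functionals; it stays approximable because some
    [f n] is uniformly close to it. *)
Lemma completion_seq_complete (f : nat -> completion P) (e : nat -> R) : e @ \oo --> 0 ->
  (forall n m, pn (f n - f m : completion_pre) <= e n + e m) ->
  exists g, forall n, pn (f n - g : completion_pre) <= e n.
Proof.
move=> e0 fe.
have ege0 n : 0 <= e n by have := fe n n; rewrite subrr pn0; lra.
have hl u : exists l, forall n, nm (cev (f n) u - l) <= e n * pn u.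
  apply: ccauchy_rate.
    by under eq_fun do rewrite mulrC; exact: cvg0Z.
  move=> n m; rewrite -cevB -mulrDl; apply: le_trans (cev_le _ _) _.
  by rewrite ler_wpM2r ?pn_ge0.
have [g hg] := choice hl.
have gP : (g : P -> R[i]^o) \in @approximable R P.
  apply/asboolP => r r0; have r2 : 0 < r / 2 by rewrite divr_gt0.
  have [n en] := cvg0_ex e0 r2.
  have [v hv] := complE (f n) r2; exists v => u.
  apply: le_trans (nm_distD (cev (f n) u) _ _) _.
  rewrite nmBC; have := hv u; have := hg u n.
  have : e n * pn u <= r / 2 * pn u by rewrite ler_wpM2r ?pn_ge0 ?ltW.
  lra.
exists (MkCompletion gP) => n; apply: pn_completion_le => // u.
by rewrite cevB; exact: hg.
Qed.

End completion_theory.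

Section completion_hilbert.
Context {R : realType} {P : prehilbert R}.

Definition cnorm (f : completion P) : R[i] := (pn (f : completion_pre))%:C%C.

Lemma cnormD f g : cnorm (f + g) <= cnorm f + cnorm g.
Proof. by rewrite /cnorm -rmorphD lecR; exact: (@pnD _ (@completion_pre R P)). Qed.

Lemma cnormZ (c : R[i]) f : cnorm (c *: f) = `|c| * cnorm f.
Proof. by rewrite /cnorm (@pnZ _ (@completion_pre R P)) nmE rmorphM. Qed.

Lemma cnorm_eq0 f : cnorm f = 0 -> f = 0.
Proof. by move=> /complexI; exact: pn_completion_eq0. Qed.

HB.instance Definition _ :=
  Lmodule_isNormed.Build R[i] (completion P) cnormD cnormZ cnorm_eq0.

End completion_hilbert.

Section completion_complete.
Context {R : realType} {P : prehilbert R}.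

Lemma nm_compl (f : completion P) : nm f = pn (f : completion_pre).
Proof. by []. Qed.

(** Points chosen in members of the filter of diameter at most 1/(n+1) form a Cauchy sequence, which
    reduces filters to sequences. *)
Lemma completion_complete (F : set_system (completion P)) :
  ProperFilter F -> cauchy F -> cvg F.
Proof.
move=> FF /cauchy_ballP cF.
have hF (n : nat) : exists A, F A /\
    forall f g, A f -> A g -> nm (f - g) < n.+1%:R^-1.
  have n0 : 0 < (n.+1%:R^-1)%:C%C :> R[i] by rewrite ltcR invr_gt0.
  have [[/= A B] [FA FB] AB] := cF _ n0.
  exists (A `&` B); split; first exact: filterI.
  move=> f g [Af _] [_ Bg]; have := AB (f, g) (conj Af Bg).
  by rewrite /= -ball_normE /= nm_lt.
have [A hA] := choice hF.
have hx (n : nat) : exists x, A n x by have [FA _] := hA n; exact: filter_ex FA.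
have [x xA] := choice hx.
have [|g hg] := @completion_seq_complete _ _ x (fun n => n.+1%:R^-1) (@cvg0_inv R).
  move=> n m; have [z [Az1 Az2]] : (A n `&` A m) !=set0.
    by apply: (@filter_ex _ F); apply: filterI; [exact: (hA n).1|exact: (hA m).1].
  have [_ Adn] := hA n; have [_ Adm] := hA m.
  rewrite -nm_compl; apply: le_trans (nm_distD z _ _) _.
  by apply: lerD; apply: ltW; [exact: Adn|exact: Adm].
apply/cvg_ex; exists g; apply/cvgrPdist_lt => /= r r0.
have [r' rE] : exists r', r = r'%:C%C by apply/complex_realP; exact: gtr0_real.
have r2 : 0 < r' / 2 by rewrite divr_gt0// -ltcR -rE.
have [n /= hn] := cvg0_ex (@cvg0_inv R) r2.
have [FA Ad] := hA n; apply: filterS FA => f Af.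
rewrite rE nm_lt; apply: le_lt_trans (nm_distD (x n) _ _) _.
have h1 : nm (x n - g) <= n.+1%:R^-1 := hg n.
have h2 := Ad _ _ (xA n) Af; rewrite (nmBC g); apply: le_lt_trans (lerD h1 (ltW h2)) _.
by rewrite (splitr r'); exact: ltrD.
Qed.

HB.instance Definition _ :=
  Uniform_isComplete.Build (completion P) completion_complete.

Lemma cip_norm (f : completion P) : cip f f = `|f| ^+ 2.
Proof. by rewrite nmE nm_compl -rmorphXn; exact: (@ip_self _ completion_pre). Qed.

End completion_complete.

Definition hilbert_completion {R : realType} (P : prehilbert R) : hilbert R :=
  @Hilbert R (completion P) (@cip R P) (@cipL R P) (@cipC R P) (@cip_norm R P).

(** * Banach star-algebras and the GNS construction *)

Section banach_star_theory.
Context {R : realType} {A : banach_star R}.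
Implicit Types (a b x y z : A) (c : R[i]).
Local Notation "a ** b" := (@bs_mul R A a b) (at level 40, left associativity).
Local Notation one := (bs_one A).
Local Notation star := (@bs_star R A).

Lemma bsDr a x y : a ** (x + y) = a ** x + a ** y.
Proof. by rewrite -[x in LHS]scale1r bs_mull scale1r. Qed.

Lemma bsDl a x y : (x + y) ** a = x ** a + y ** a.
Proof.
by have := @bs_mulr R A a 1 x y; rewrite /= !scale1r.
Qed.

Lemma bs0r a : a ** 0 = 0.
Proof. by apply: (@addrI _ (a ** 0)); rewrite -bsDr !addr0. Qed.

Lemma bs0l a : 0 ** a = 0.
Proof. by apply: (@addrI _ (0 ** a)); rewrite -bsDl !addr0. Qed.

Lemma bsZr c a x : a ** (c *: x) = c *: (a ** x).
Proof. by rewrite -[c *: x]addr0 bs_mull bs0r addr0. Qed.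

Lemma bsZl c a x : (c *: x) ** a = c *: (x ** a).
Proof.
by have := @bs_mulr R A a c x 0; rewrite /= bs0l !addr0.
Qed.

Lemma bsNr a x : a ** (- x) = - (a ** x).
Proof. by rewrite -scaleN1r bsZr scaleN1r. Qed.

Lemma bsNl a x : (- x) ** a = - (x ** a).
Proof. by rewrite -scaleN1r bsZl scaleN1r. Qed.

Lemma starD x y : star (x + y) = star x + star y.
Proof. by rewrite -[x in LHS]scale1r bs_starL conjC1 scale1r. Qed.

Lemma star0 : star 0 = 0.
Proof. by apply: (@addrI _ (star 0)); rewrite -starD !addr0. Qed.

Lemma starZ c x : star (c *: x) = c^* *: star x.
Proof. by rewrite -[c *: x]addr0 bs_starL star0 addr0. Qed.

Lemma starN x : star (- x) = - star x.
Proof. by rewrite -scaleN1r starZ rmorphN1 scaleN1r. Qed.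

Lemma star1 : star one = one.
Proof.
by rewrite -[LHS]bs_mul1r -{2}[one]bs_starK -bs_starM bs_mul1r bs_starK.
Qed.

Lemma nm_bsM a b : nm (a ** b) <= nm a * nm b.
Proof. by have := bs_normM a b; rewrite !nmE -rmorphM lecR. Qed.

Lemma nm_star a : nm (star a) = nm a.
Proof. by rewrite /nm bs_norm_star. Qed.

Lemma nmZ (V : normedModType R[i]) c (x : V) : nm (c *: x) = nm c * nm x.
Proof. by apply: complexI; rewrite -nmE normrZ !nmE -rmorphM. Qed.

(* 1 - h is the square of 1 - z where z = (h + z^2) / 2 *)
Lemma bs_sqrt h : star h = h -> nm h < 1 ->
  exists2 y, star y = y & y ** y = one - h.
Proof.
move=> hs h1; set r := nm h; have r0 : 0 <= r by exact: nm_ge0.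
pose F z : A := (2^-1)%:C%C *: (h + z ** z).
have nmF x : nm (F x) = 2^-1 * nm (h + x ** x) by rewrite nmZ nm_real ger0_norm ?invr_ge0 ?ler0n//.
have Fdist x y : nm (F x - F y) <= 2^-1 * ((nm x + nm y) * nm (x - y)).
  have -> : F x - F y = (2^-1)%:C%C *: (x ** (x - y) + (x - y) ** y).
    rewrite -scalerBr; congr (_ *: _).
    rewrite bsDr bsDl bsNr bsNl opprD !addrA; congr (_ - _).
    by rewrite subrK addrAC subrr add0r.
  rewrite nmZ nm_real ger0_norm ?invr_ge0 ?ler0n// ler_wpM2l// mulrDl.
  apply: le_trans (nmD _ _) _.
  by apply: lerD; [|rewrite mulrC]; exact: nm_bsM.
(* F maps the ball of radius r into itself, as [(r + r^2) / 2 <= r], and contracts it by the factor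
   [(r + r) / 2 = r < 1]. *)
pose z n := iter n F 0.
have zr n : nm (z n) <= r.
  elim: n => [|n IH]; first by rewrite /= nm0.
  rewrite [z _]/= nmF.
  have h2 : nm (h + z n ** z n) <= r + r * r.
    apply: le_trans (nmD _ _) _; rewrite lerD2l.
    by apply: le_trans (nm_bsM _ _) _; apply: ler_pM; rewrite ?nm_ge0.
  have : r * r <= r by rewrite ler_piMl// ltW.
  lra.
have zd n : nm (z n.+1 - z n) <= r ^+ n.
  elim: n => [|n IH].
    by rewrite expr0; apply: le_trans (ltW h1); rewrite subr0; exact: (zr 1).
  rewrite exprS; apply: le_trans (Fdist (z n.+1) (z n)) _.
  have : (nm (z n.+1) + nm (z n)) * nm (z n.+1 - z n) <= (r + r) * r ^+ n.
    by apply: ler_pM; rewrite ?addr_ge0 ?nm_ge0// lerD.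
  by rewrite mulrDl; lra.
pose e n := r ^+ n / (1 - r).
have r1 : 0 < 1 - r by rewrite subr_gt0.
have ege0 n : 0 <= e n by rewrite divr_ge0 ?exprn_ge0// ltW.
have e0 : e @ \oo --> 0.
  rewrite /e; under eq_fun do rewrite mulrC.
  by apply: cvg0Z; apply: cvg_expr; rewrite ger0_norm.
have zk n k : nm (z n - z (n + k)%N) <= e n - e (n + k)%N.
  elim: k => [|k IH]; first by rewrite addn0 !subrr nm0.
  rewrite addnS; apply: le_trans (nm_distD (z (n + k)%N) _ _) _.
  have -> : e n - e (n + k).+1 = (e n - e (n + k)%N) + r ^+ (n + k).
    by rewrite /e exprS; field; rewrite gt_eqF.
  by apply: lerD => //; rewrite nmBC; exact: zd.
have ze n m : nm (z n - z m) <= e n + e m.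
  have le_nm i j : (i <= j)%N -> nm (z i - z j) <= e i + e j.
    move=> ij; have := zk i (j - i)%N; rewrite subnKC// => /le_trans; apply.
    by have := ege0 j; lra.
  case/orP: (leq_total n m) => /le_nm // h2.
  by rewrite nmBC [leRHS]addrC.
have [l hl] := complete_rate e0 ze.
have lF : l = F l.
  apply/subr0_eq/nm_eq0/eqP; rewrite eq_le nm_ge0 andbT.
  pose C := 2^-1 * (r + nm l).
  apply: (@cvg0_le _ (fun n => e n.+1 + C * e n)).
    apply: cvg0D; last exact: cvg0Z.
    by have := cvg_shiftS e; move=> ->.
  move=> n; rewrite add0r; apply: le_trans (nm_distD (z n.+1) _ _) _.
  apply: lerD; first by rewrite nmBC.
  apply: le_trans (Fdist _ _) _; rewrite /C -mulrA ler_wpM2l//.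
  by apply: ler_pM; rewrite ?addr_ge0 ?nm_ge0// lerD.
have ls : star l = l.
  have zs n : star (z n) = z n.
    elim: n => [|n IH]; first exact: star0.
    by rewrite [z _]/= starZ starD bs_starM IH hs conjCE /= oppr0.
  apply/subr0_eq/nm_eq0/eqP; rewrite eq_le nm_ge0 andbT.
  apply: (@cvg0_le _ (fun n => e n + e n)); first exact: cvg0D.
  move=> n; rewrite add0r; apply: le_trans (nm_distD (z n) _ _) _.
  apply: lerD => //.
  by rewrite -{1}[z n]zs -starN -starD nm_star nmBC.
exists (one - l); first by rewrite starD starN star1 ls.
have lE : l + l = h + l ** l.
  rewrite {1 2}lF /F -scalerDl -rmorphD /= (_ : 2^-1 + 2^-1 = 1) ?scale1r//.
  by field.
have hE : h = l + l - l ** l by rewrite lE addrK.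
by rewrite bsDr bs_mul1r bsNr bsDl bs_mul1l bsNl hE !opprD !opprK !addrA.
Qed.

End banach_star_theory.

(** * Positive functionals, contractivity of representations and GNS triples *)

Section positive_functionals.
Context {R : realType} {A : banach_star R}.
Local Notation "a ** b" := (@bs_mul R A a b) (at level 40, left associativity).
Local Notation one := (bs_one A).
Local Notation star := (@bs_star R A).

(* 1 - a^* a / (|a|^2 + e) is a square y^* y for every e > 0. *)
Lemma positive_bound (phi : A -> R[i]) :
  (forall (c : R[i]) a b, phi (c *: a + b) = c * phi a + phi b) ->
  (forall a, 0 <= complex.Re (phi (star a ** a))) ->
  forall a, complex.Re (phi (star a ** a)) <= nm a ^+ 2 * complex.Re (phi one).
Proof.
move=> phiL phi_ge0 a; set t := complex.Re (phi one).
have t0 : 0 <= t by have := phi_ge0 one; rewrite star1 bs_mul1l.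
apply/ler_addgt0Pr => e e0.
pose k := nm a ^+ 2 + e / (t + 1).
have t1 : 0 < t + 1 by rewrite ltr_wpDl.
have k0 : 0 < k by rewrite ltr_wpDl ?sqr_ge0// divr_gt0.
pose h := (k^-1)%:C%C *: (star a ** a).
have hs : star h = h.
  by rewrite /h starZ bs_starM bs_starK conjCE /= oppr0.
have h1 : nm h < 1.
  rewrite nmZ nm_real ger0_norm ?invr_ge0 1?ltW// mulrC ltr_pdivrMr// mul1r.
  apply: le_lt_trans (nm_bsM _ _) _; rewrite nm_star -expr2 /k.
  by rewrite ltrDl divr_gt0.
have [y ys yy] := bs_sqrt hs h1.
have := phi_ge0 y; rewrite ys yy.
have -> : phi (one - h) = phi one - (k^-1)%:C%C * phi (star a ** a).
  rewrite addrC /h -scaleNr phiL; ring.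
set q := phi (star a ** a); rewrite raddfB /= -/t.
have -> : complex.Re ((k^-1)%:C%C * q) = k^-1 * complex.Re q.
  by case: (q) => u v /=; rewrite mul0r subr0.
rewrite subr_ge0 mulrC ler_pdivrMr// => /le_trans; apply.
rewrite /k mulrDr (mulrC t (_ ^+ _)) lerD2l mulrA ler_pdivrMr// mulrC.
by rewrite ler_wpM2l ?ltW// ltrDl.
Qed.

Lemma rep_starr (H : hilbert R) (p : star_rep A H) a x y :
  h_inner x (p (star a) y) = h_inner (p a x) y.
Proof. by rewrite -[a in RHS]bs_starK rep_star. Qed.

(** [positive_bound] for the functional [b |-> <x, p b x>], whose value at [star b ** b] is the
    square of the norm of [p b x]. *)
Lemma rep_contract (H : hilbert R) (p : star_rep A H) a x :
  nm (p a x) <= nm a * nm x.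
Proof.
have E b : h_inner x (p (star b ** b) x) = (nm (p b x) ^+ 2)%:C%C.
  by rewrite rep_mul rep_starr h_inner_norm nmE -rmorphXn.
(* A degenerate representation sends the unit to a projection only; [|p one x|^2 = <x, p one x> <=
   |x| |p one x|] gives the bound. *)
have p1 : complex.Re (h_inner x (p one x)) <= nm x ^+ 2.
  have := E one; rewrite star1 bs_mul1l => E1.
  have := @Re_ip_le R (hilbert_pre H) x (p one x); rewrite !pn_hilbert_pre /= E1 /= => h.
  have [->|n0] := eqVneq (nm (p one x)) 0; first by rewrite expr0n sqr_ge0.
  have n1 : 0 < nm (p one x) by rewrite lt_def n0 nm_ge0.
  rewrite ler_pXn2r ?nnegrE ?nm_ge0//.
  by move: h; rewrite expr2 ler_pM2r.
have := @positive_bound (fun b => h_inner x (p b x)) _ _ a.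
rewrite E /= => h; rewrite -(@ler_pXn2r _ 2) ?nnegrE ?mulr_ge0 ?nm_ge0//.
apply: le_trans (h _ _) _ => [c b b'|b|].
- by rewrite rep_linearl h_innerL.
- by rewrite E /= sqr_ge0.
- by rewrite exprMn ler_wpM2l ?sqr_ge0.
Qed.

Section state_prehilbert.
Variable w : state A.

Lemma stateD a b : w (a + b) = w a + w b.
Proof. by rewrite -[a in LHS]scale1r state_linear mul1r. Qed.

Lemma state0 : w 0 = 0.
Proof. by apply: (@addrI _ (w 0)); rewrite -stateD !addr0. Qed.

Lemma stateZ (c : R[i]) a : w (c *: a) = c * w a.
Proof. by rewrite -[c *: a]addr0 state_linear state0 addr0. Qed.

(** Polarisation: positivity at [x + y] makes the imaginary parts of the two mixed terms cancel; b
    and then i b yield the imaginary and the real part of the identity. *)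
Lemma state_herm a b : w (star b ** a) = (w (star a ** b))^*.
Proof.
have im a' : complex.Im (w (star a' ** a')) = 0.
  by have := state_pos w a'; rewrite lecE /= => /andP[/eqP].
have key x y : complex.Im (w (star x ** y)) + complex.Im (w (star y ** x)) = 0.
  have := im (x + y); rewrite starD bsDl !bsDr !stateD !raddfD /= !im.
  by rewrite addr0 add0r.
have h1 := key a b; have := key a ('i%C *: b).
rewrite starZ bsZl bsZr !stateZ.
case: (w (star b ** a)) (w (star a ** b)) h1 => p q [r s] /= h1 h2.
rewrite conjCE; apply/eqP; rewrite eq_complex /=; apply/andP; split; apply/eqP.
  by move: h2; lra.
by move: h1; lra.
Qed.

Definition state_pre : prehilbert R.
Proof.
exists A (fun a b => w (star a ** b)).
- by move=> a c b d; rewrite bsDr bsZr state_linear.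
- by move=> a b; rewrite state_herm.
- exact: state_pos.
Defined.

(** [positive_bound] for the functional [c |-> w (star b ** c ** b)]. It makes left multiplication
    continuous for the GNS seminorm. *)
Lemma pn_state_mul a (b : state_pre) : pn (a ** b : state_pre) <= nm a * pn b.
Proof.
rewrite -(@ler_pXn2r _ 2) ?nnegrE ?mulr_ge0 ?nm_ge0 ?pn_ge0// exprMn !pn_sqr /=.
rewrite bs_starM bs_mulA -(bs_mulA (star b)).
have := @positive_bound (fun c => w (star b ** c ** b)) _ _ a.
rewrite bs_mul1r; apply => [c x y|c].
  by rewrite bsDr bsDl bsZr bsZl state_linear.
have := state_pos w (c ** b).
by rewrite bs_starM -!bs_mulA lecE => /andP[].
Qed.

Local Notation H := (hilbert_completion state_pre).

(** On functionals a acts by transposition, which sends [<., v>] to [<., a v>]; an approximant v of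
    f thus yields the approximant [a ** v]. *)
Lemma gns_opP a (f : completion state_pre) :
  (fun u => cev f (star a ** u) : R[i]^o) \in @approximable R state_pre.
Proof.
apply/asboolP => e e0.
have a1 : 0 < nm a + 1 by rewrite ltr_wpDl ?nm_ge0.
have [v hv] := complE f (divr_gt0 e0 a1).
exists (a ** v : state_pre) => u.
rewrite (_ : ph_ip u _ = ph_ip (star a ** u : state_pre) v); last first.
  by rewrite /= bs_starM bs_starK bs_mulA.
apply: le_trans (hv _) _.
apply: (@le_trans _ _ (e / (nm a + 1) * (nm a * pn u))).
  apply: ler_wpM2l; first by rewrite divr_ge0// ltW.
  by rewrite -(nm_star a); exact: pn_state_mul.
rewrite mulrA ler_wpM2r ?pn_ge0// mulrAC ler_pdivrMr// ler_wpM2l ?ltW//.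
by rewrite ltrDl.
Qed.

Definition gns_op a (f : completion state_pre) : completion state_pre :=
  MkCompletion (gns_opP a f).

Lemma cev_gns_op a f u : cev (gns_op a f) u = cev f (star a ** u : state_pre).
Proof. by []. Qed.

Lemma approx_gns_op a f v e : approx f v e ->
  approx (gns_op a f) (fun n => a ** v n : state_pre) (fun n => nm a * e n).
Proof.
move=> [e0 ege0 h]; split=> [|n|n u]; first exact: cvg0Z.
  by rewrite mulr_ge0 ?nm_ge0.
rewrite cev_gns_op (_ : ph_ip u _ = ph_ip (star a ** u : state_pre) (v n)); last first.
  by rewrite /= bs_starM bs_starK bs_mulA.
apply: le_trans (h _ _) _; rewrite -mulrA [leRHS]mulrCA.
by apply: ler_wpM2l => //; rewrite -(nm_star a); exact: pn_state_mul.
Qed.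

Lemma gns_op_bound a (f : H) : nm (gns_op a f : H) <= nm a * nm f.
Proof.
apply: pn_completion_le => [|u]; first by rewrite mulr_ge0 ?nm_ge0.
rewrite cev_gns_op; apply: le_trans (cev_le _ _) _.
rewrite (mulrC (nm a)) -mulrA ler_wpM2l ?pn_ge0//.
by rewrite -(nm_star a); exact: pn_state_mul.
Qed.

Definition gns_star_rep : star_rep A H.
Proof.
exists (gns_op : A -> H -> H).
- move=> f c a b; apply: compl_ext => u.
  rewrite cevL !cev_gns_op starD starZ bsDl bsZl.
  by rewrite (@cev_linearl _ state_pre) conjCK.
- by move=> a c f g; apply: compl_ext => u.
- by move=> a; exists `|a| => f; rewrite !nmE -rmorphM lecR; exact: gns_op_bound.
- move=> a b f; apply: compl_ext => u.
  by rewrite !cev_gns_op bs_starM bs_mulA.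
- move=> a f g; have fa := aseqP f; have ga := aseqP g.
  apply: cto_unique (cip_cto (approx_gns_op (star a) fa) ga) _.
  apply: cto_ext (cip_cto fa (approx_gns_op a ga)) => n.
  by rewrite /= bs_starM bs_starK bs_mulA.
Defined.

Lemma gns_ex : {G : gns w | True}.
Proof.
have E a : gns_star_rep a (emb (one : state_pre)) = emb (a : state_pre).
  by apply: compl_ext => u; rewrite cev_gns_op !cev_emb /= bs_starM bs_starK bs_mul1r.
unshelve eexists; [exists H gns_star_rep (emb (one : state_pre))|by []].
- move=> a; rewrite E /= cip_emb cev_emb /= star1 bs_mul1l//.
- apply/seteqP; split=> // f _; apply/closureP => e e0.
  have [u hu] := @emb_dense _ state_pre f (e / 2) ltac:(by rewrite divr_gt0).
  exists (emb u); first by exists (u : A).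
  by apply: le_lt_trans hu _; rewrite ltr_pdivrMr// ltr_pMr// ltr1n.
Qed.

End state_prehilbert.
End positive_functionals.

(** * States on Weyl algebras *)

Section trigonometry.
Context {R : realType}.
Implicit Types x y : R.

Lemma sin_le x : 0 <= x -> `|sin x| <= x.
Proof.
move=> x0; have [->|xN0] := eqVneq x 0; first by rewrite sin0 normr0.
have x_gt0 : 0 < x by rewrite lt_def xN0.
have [c _] := @MVT_segment R sin cos 0 x x0 (fun y _ => is_derive_sin y)
  (continuous_subspaceT (@continuous_sin R)).
rewrite sin0 !subr0 => ->.
by rewrite normrM (ger0_norm x0) ler_piMl// cos_max.
Qed.

Lemma sin_sqr_le x : sin x ^+ 2 <= x ^+ 2.
Proof.
have h y : 0 <= y -> sin y ^+ 2 <= y ^+ 2.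
  move=> y0; rewrite -(real_normK (num_real (sin y))) ler_pXn2r ?nnegrE//.
  exact: sin_le.
have [/h //|x0] := leP 0 x.
by rewrite -[sin x]opprK -sinN sqrrN -[x ^+ 2]sqrrN h// oppr_ge0 ltW.
Qed.

Lemma cos_ge_quad x : 1 - x ^+ 2 / 2 <= cos x.
Proof.
have -> : cos x = 1 - 2 * sin (x / 2) ^+ 2.
  have -> : cos x = cos ((x / 2) *+ 2) by rewrite mulr2n -splitr.
  by rewrite cos_mulr2n sin2cos2; ring.
by have := sin_sqr_le (x / 2); rewrite exprMn; lra.
Qed.

(** Meant for the real part of a Weyl matrix element, a phase times a Gaussian: a lower bound there
    is an upper bound on the distance of unit vectors. *)
Lemma cos_expR_ge x y : 0 <= y -> 1 - (x ^+ 2 / 2 + y) <= cos x * expR (- y).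
Proof.
move=> y0; have h1 := cos_ge_quad x; have h2 := expR_ge1Dx (- y).
have h3 : expR (- y) <= 1 by rewrite expR_le1 oppr_le0.
have h4 := expR_ge0 (- y); have h5 := cos_le1 x.
have : (1 - cos x) * expR (- y) <= 1 - cos x by rewrite ler_piMr// subr_ge0.
rewrite mulrBl mul1r; lra.
Qed.

Lemma expi0 : expi (0 : R) = 1.
Proof. by rewrite /expi cos0 sin0. Qed.

Lemma expiD x y : expi (x + y) = expi x * expi y.
Proof.
rewrite /expi cosD sinD; apply/eqP; rewrite eq_complex /=.
by apply/andP; split=> //; rewrite addrC.
Qed.

Lemma expi_dist x y : nm (expi x - expi y) <= `|x - y|.
Proof.
rewrite -(@ler_pXn2r _ 2) ?nnegrE ?nm_ge0// real_normK ?num_real//.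
rewrite nm_sqr /=; have := cos_ge_quad (x - y); rewrite cosB => h.
have := cos2Dsin2 x; have := cos2Dsin2 y; nra.
Qed.

End trigonometry.

(** * Norm bounds and density in the Weyl algebra *)

Section weyl_theory.
Context {R : realType} {V : lmodType R} {s : V -> V -> R}.
Variable A : weyl_algebra s.
Local Notation W := (@weyl R V s A).
Local Notation "a ** b" := (@bs_mul R A a b) (at level 40, left associativity).

(** The C*-norm is a supremum of operator norms, each at most the l^1-norm by [rep_contract]. *)
Lemma wa_map_contract (a : wa_l1 A) : nm (wa_map a) <= nm a.
Proof.
rewrite {1}/nm wa_norm /cstar_norm; set E := [set _ | _].
(* By convention the supremum of the empty set is 0. *)
have [->|E0] := eqVneq E set0; first by rewrite sup0 nm_ge0.
apply: ge_sup; first exact/set0P.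
move=> _ [H [p [_ _ ->]]]; apply: ge_sup.
  by exists (complex.Re `|p a 0|); exists 0 => //; rewrite normr0.
move=> _ [x x1 ->]; apply: le_trans (rep_contract p a x) _.
rewrite ler_piMr ?nm_ge0//.
by move: x1; rewrite -[1]/(1%:C%C) nm_le.
Qed.

Lemma wa_map0 : wa_map 0 = 0 :> A.
Proof.
by have := @wa_linear _ _ _ A (-1) 0 0; rewrite addr0 scaler0 scaleN1r addNr.
Qed.

Lemma wa_mapZ (c : R[i]) a : wa_map (c *: a) = c *: wa_map a :> A.
Proof.
by have := @wa_linear _ _ _ A c a 0; rewrite wa_map0 !addr0.
Qed.

(** Two densities are combined: combinations of the W(f) in the l^1-algebra, then the image of that
    algebra in A. Contractivity of [wa_map] carries the first approximation over to A. *)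
Lemma weyl_ind (Q : A -> Prop) : Q 0 ->
  (forall (c : R[i]) a b, Q a -> Q b -> Q (c *: a + b)) ->
  (forall f, Q (W f)) ->
  (forall a, (forall e : R, 0 < e -> exists2 b, Q b & nm (a - b) < e) -> Q a) ->
  forall a, Q a.
Proof.
move=> Q0 QL QW Qcl.
have wL c a b : wa_map (c *: a + b) = c *: wa_map a + wa_map b :> A.
  exact: wa_linear.
have Qmap (a : wa_l1 A) : Q (wa_map a).
  have : closure (linear_span (range (@wl_W _ _ _ (wa_l1 A)))) a.
    by rewrite wl_dense.
  move=> /closureP ca; apply: Qcl => e /ca [b [m [c [x [xW ->]]]] ab].
  exists (wa_map (\sum_(i < m) c i *: x i)).
    elim/big_rec: _ => [|i y _ Qy]; first by rewrite wa_map0.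
    by rewrite wL; apply: QL => //; have [f _ <-] := xW i; exact: QW.
  have -> : wa_map a - wa_map (\sum_(i < m) c i *: x i) =
      wa_map (a - \sum_(i < m) c i *: x i) :> A.
    by have := wL (-1) (\sum_(i < m) c i *: x i) a; rewrite !scaleN1r addrC => ->; rewrite addrC.
  by apply: le_lt_trans (wa_map_contract _) ab.
move=> a; have : closure (range (@wa_map _ _ _ A)) a by rewrite wa_dense.
move=> /closureP ca; apply: Qcl => e /ca [b [x _ <-] ab].
by exists (wa_map x).
Qed.

Lemma weylM f g : W f ** W g = expi (- (s f g / 2)) *: W (f + g).
Proof.
by rewrite /weyl -wa_mul; have [-> _] := wl_relations (wa_l1 A); rewrite wa_mapZ.
Qed.

Lemma weyl_star f : bs_star (W f) = W (- f).
Proof. by rewrite /weyl -wa_star; have [_ ->] := wl_relations (wa_l1 A). Qed.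

Lemma nm_weyl f : nm (W f) <= 1.
Proof.
apply: le_trans (wa_map_contract _) _.
have := @wl_norm _ _ _ (wa_l1 A) 1 (fun=> 1) (fun=> f).
rewrite !big_ord1 scale1r normr1 /nm => -> //.
by move=> i j _; rewrite !ord1.
Qed.
End weyl_theory.

(** * Positive real forms and approximate Riesz representation *)

Record real_form (R : realType) (V : lmodType R) := RealForm {
  rf :> V -> V -> R;
  rfL : forall f c g h, rf f (c *: g + h) = c * rf f g + rf f h;
  rfC : forall f g, rf f g = rf g f;
  rf_ge0 : forall f, 0 <= rf f f }.

Section real_form_theory.
Context {R : realType} {V : lmodType R} (b : real_form V).
Implicit Types (f g h : V) (t c : R).

Lemma rfDr f g h : b f (g + h) = b f g + b f h.
Proof. by rewrite -[g in LHS]scale1r rfL mul1r. Qed.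

Lemma rf0r f : b f 0 = 0.
Proof. by apply: (@addrI _ (b f 0)); rewrite -rfDr !addr0. Qed.

Lemma rfZr f c g : b f (c *: g) = c * b f g.
Proof. by rewrite -[c *: g]addr0 rfL rf0r addr0. Qed.

Definition rq f : R := Num.sqrt (b f f).

Lemma rq_ge0 f : 0 <= rq f. Proof. exact: sqrtr_ge0. Qed.

Lemma rq_sqr f : rq f ^+ 2 = b f f.
Proof. by rewrite sqr_sqrtr ?rf_ge0. Qed.

Lemma rq0 : rq 0 = 0.
Proof. by rewrite /rq rf0r sqrtr0. Qed.

Lemma rq_sqrDZ f c g :
  rq (f + c *: g) ^+ 2 = rq f ^+ 2 + 2 * c * b f g + c ^+ 2 * rq g ^+ 2.
Proof.
rewrite !rq_sqr rfDr rfZr (rfC b (f + c *: g) f) (rfC b (f + c *: g) g) !rfDr.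
rewrite !rfZr (rfC b g f); ring.
Qed.

Lemma rqZ c g : rq (c *: g) = `|c| * rq g.
Proof.
apply/eqP; rewrite -(@eqrXn2 _ 2) ?mulr_ge0 ?rq_ge0//.
by rewrite exprMn real_normK ?num_real// !rq_sqr rfZr rfC rfZr mulrA -expr2.
Qed.

Lemma rqN g : rq (- g) = rq g.
Proof. by rewrite -scaleN1r rqZ normrN1 mul1r. Qed.

Lemma rqBC f g : rq (f - g) = rq (g - f).
Proof. by rewrite -opprB rqN. Qed.

Lemma rf_le f g : `|b f g| <= rq f * rq g.
Proof.
rewrite -(@ler_pXn2r _ 2) ?nnegrE ?mulr_ge0 ?rq_ge0// real_normK ?num_real//.
rewrite exprMn; apply: discr_le => [||t]; rewrite ?sqr_ge0//.
by rewrite -rq_sqrDZ sqr_ge0.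
Qed.

Lemma rqD f g : rq (f + g) <= rq f + rq g.
Proof.
rewrite -(@ler_pXn2r _ 2) ?nnegrE ?addr_ge0 ?rq_ge0//.
have := rq_sqrDZ f 1 g; rewrite scale1r => ->.
by have := le_trans (ler_norm _) (rf_le f g); nra.
Qed.

(* A minimising sequence of |h|^2 / 2 - l h: the parallelogram identity makes it
   Cauchy, and the derivative of the functional tends to 0 along it. *)
Lemma riesz_approx (l : V -> R) (C : R) :
  (forall c f g, l (c *: f + g) = c * l f + l g) ->
  (forall f, `|l f| <= C * rq f) ->
  exists (h : nat -> V) (e : nat -> R), [/\ e @ \oo --> 0,
    forall n m, rq (h n - h m) <= e n + e m &
    forall n f, `|b (h n) f - l f| <= e n * rq f].
Proof.
move=> lL lC.
have l0 : l 0 = 0 by have := lL (-1) 0 0; rewrite scaler0 addr0 mulN1r addNr.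
have lZ c f : l (c *: f) = c * l f by rewrite -[c *: f]addr0 lL l0 addr0.
have lD f g : l (f + g) = l f + l g by rewrite -[f in LHS]scale1r lL mul1r.
pose J f := rq f ^+ 2 / 2 - l f.
have Jhas : has_inf (range J).
  split; first by exists (J 0), 0.
  exists (- (C ^+ 2 / 2)) => _ [f _ <-]; rewrite /J.
  have := le_trans (ler_norm _) (lC f); have := sqr_ge0 (rq f - C).
  by rewrite sqrrB; lra.
set m := inf (range J).
have Jm f : m <= J f by apply: ge_inf; [exact: Jhas.2|exists f].
pose e (n : nat) : R := n.+1%:R^-1.
have e_gt0 n : 0 < e n by rewrite invr_gt0.
(* With this tolerance the parallelogram identity yields [|h i - h j|^2 <= e i ^+ 2 + e j ^+ 2]. *)
have hJ n : exists f, J f < m + e n ^+ 2 / 4.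
  have [] := @inf_adherent _ (range J) (e n ^+ 2 / 4) _ Jhas.
    by rewrite divr_gt0// exprn_gt0.
  by move=> _ [f _ <-] h; exists f.
have [h hh] := choice hJ; exists h, e; split; first exact: cvg0_inv.
  move=> i j; rewrite -(@ler_pXn2r _ 2) ?nnegrE ?rq_ge0 ?addr_ge0 ?(ltW (e_gt0 _))//.
  have := Jm ((2^-1 : R) *: (h i + h j)); have := hh i; have := hh j.
  rewrite /J lZ lD rqZ ger0_norm// !exprMn.
  have := rq_sqrDZ (h i) 1 (h j); rewrite scale1r => ->.
  have := rq_sqrDZ (h i) (-1) (h j); rewrite scaleN1r => ->.
  have := mulr_ge0 (ltW (e_gt0 i)) (ltW (e_gt0 j)); lra.
move=> n f; rewrite -(@ler_pXn2r _ 2) ?nnegrE ?mulr_ge0 ?rq_ge0 ?(ltW (e_gt0 n))//.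
rewrite real_normK ?num_real//.
(* [J (h n + t *: f) - J (h n)] is at least [- (e n ^+ 2 / 4)] for all t; this is the discriminant
   inequality for that quadratic in t. *)
suff : ((b (h n) f - l f) / 2) ^+ 2 <= e n ^+ 2 / 4 * (rq f ^+ 2 / 2).
  rewrite !exprMn; have := mulr_ge0 (sqr_ge0 (e n)) (sqr_ge0 (rq f)); lra.
apply: discr_le => [||t]; try by apply: divr_ge0; rewrite ?sqr_ge0.
have := Jm (h n + t *: f); have := hh n.
rewrite /J rq_sqrDZ lD lZ; lra.
Qed.

End real_form_theory.

Lemma cvg0_approx {R : realType} (x : nat -> R) : (forall n, 0 <= x n) ->
  (forall e : R, 0 < e ->
     exists2 d : nat -> R, d @ \oo --> 0 & forall n, x n <= d n + e) ->
  x @ \oo --> 0.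
Proof.
move=> x0 h; apply/cvgrPdist_lt => e e0.
have e2 : 0 < e / 2 by rewrite divr_gt0.
have [d /cvgrPdist_lt /(_ _ e2) [N _ dN] xd] := h _ e2.
exists N => // n /dN /=; rewrite !sub0r !normrN (ger0_norm (x0 n)).
have := xd n; have := ler_norm (d n); lra.
Qed.

Section star_rep_theory.
Context {R : realType} {B : banach_star R} {H : hilbert R} (p : star_rep B H).

Lemma repBr a x y : p a (x - y) = p a x - p a y.
Proof.
have := rep_linear p a (-1) y x.
by rewrite !scaleN1r (addrC (- y)) (addrC (- p a y)).
Qed.

Lemma repBl a a' x : p (a - a') x = p a x - p a' x.
Proof.
have := rep_linearl p x (-1) a' a.
by rewrite /= !scaleN1r (addrC (- a')) (addrC (- p a' x)).
Qed.

Lemma rep0l x : p 0 x = 0.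
Proof. by have := repBl 0 0 x; rewrite !subrr. Qed.

End star_rep_theory.

(** Unitality comes from cyclicity: the image of the unit is bounded and fixes the dense set of
    vectors [p a (gns_vec G)]. *)
Lemma gns_rep1 {R : realType} {B : banach_star R} (v : state B) (G : gns v) x :
  gns_rep G (bs_one B) x = x.
Proof.
set p := gns_rep G; apply/subr0_eq/nm_eq0/eqP; rewrite eq_le nm_ge0 andbT.
apply/ler_addgt0Pr => e e0; rewrite add0r.
have k0 : 0 < nm (bs_one B) + 1 by rewrite ltr_wpDl ?nm_ge0.
have : closure [set p a (gns_vec G) | a in setT] x by rewrite gns_cyclic.
move=> /closureP /(_ _ (divr_gt0 e0 k0)) [_ [a _ <-] xa].
apply: le_trans (nm_distD (p a (gns_vec G)) _ _) _.
rewrite -{1}[a]bs_mul1l rep_mul -repBr.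
apply: le_trans (lerD (rep_contract p _ _) (lexx _)) _.
rewrite (nmBC (p a _)) -[X in _ + X]mul1r -mulrDl mulrC -ler_pdivlMr//.
exact: ltW.
Qed.

(** * Weyl operators in the Fock representation *)

Section fock_states.
Context {R : realType} {V : lmodType R} {s : V -> V -> R}.
Variables (b : real_form V) (A : weyl_algebra s).
Hypothesis sDl : forall f g h, s (f + g) h = s f h + s g h.
Hypothesis s_anti : forall f g, s g f = - s f g.
Hypothesis s_le : forall f g, `|s f g| <= rq b f * rq b g.
Variable w : state A.
Hypothesis wE : forall f, w (weyl f) = (expR (- (rq b f ^+ 2 / 4)))%:C%C.
Local Notation W := (@weyl R V s A).
Local Notation q := (rq b).

Lemma s_self f : s f f = 0.
Proof. by have := s_anti f f; lra. Qed.

Lemma sNl f g : s (- f) g = - s f g.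
Proof.
have s0 h : s 0 h = 0 by have := sDl 0 0 h; rewrite addr0; lra.
by have := sDl f (- f) g; rewrite subrr s0; lra.
Qed.

Lemma sDr f g h : s f (g + h) = s f g + s f h.
Proof. by rewrite s_anti sDl opprD -!s_anti. Qed.

Lemma wW_Re f : complex.Re (w (W f)) = expR (- (q f ^+ 2 / 4)).
Proof. by rewrite wE. Qed.

Section in_gns.
Variable G : gns w.
Local Notation H := (gns_space G).
Local Notation p := (gns_rep G).
Local Notation O := (gns_vec G).

Lemma weyl_ip f g : h_inner (p (W f) O) (p (W g) O) =
  expi (s f g / 2) * (expR (- (q (g - f) ^+ 2 / 4)))%:C%C.
Proof.
rewrite -rep_starr -rep_mul -gns_state weyl_star weylM stateZ wE.
by rewrite sNl mulNr opprK addrC.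
Qed.

(** The half phases of the two Weyl products add up to a full one, while the labels -h and h
    cancel. *)
Lemma weyl_sandwich f h : h_inner (p (W h) O) (p (W f) (p (W h) O)) =
  expi (s h f) * w (W f).
Proof.
rewrite -rep_starr -!rep_mul -gns_state weyl_star -bs_mulA weylM.
rewrite bsZr weylM scalerA stateZ -expiD; congr (expi _ * w (W _)).
  by rewrite sNl sDr s_self (s_anti h f); lra.
by rewrite addrCA addNr addr0.
Qed.

Lemma nm_weyl_vec f : nm (p (W f) O) = 1.
Proof.
have := @ip_self _ (hilbert_pre H) (p (W f) O).
rewrite /= weyl_ip s_self mul0r expi0 mul1r subrr rq0 expr0n mul0r oppr0 expR0.
rewrite pn_hilbert_pre => /complexI /esym /eqP.
by rewrite sqrp_eq1 ?nm_ge0// => /eqP.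
Qed.

Lemma nm_sqrB (x y : H) :
  nm (x - y) ^+ 2 = nm x ^+ 2 - 2 * complex.Re (h_inner x y) + nm y ^+ 2.
Proof.
have := @pn_sqrD _ (hilbert_pre H) x (- y).
by rewrite pnN !pn_hilbert_pre (@ipNr _ (hilbert_pre H)) raddfN /= mulrN.
Qed.

Lemma ip_norm_le (x y : H) : nm (h_inner x y) <= nm x * nm y.
Proof. by have := @ip_le _ (hilbert_pre H) x y; rewrite !pn_hilbert_pre. Qed.

(** The squared distance is 2 minus twice the real part of [weyl_ip]. Since [s f f = 0], the phase
    [s f g] equals [- s f (f - g)] and is small with [q (f - g)]. *)
Lemma weyl_vec_dist f g :
  nm (p (W f) O - p (W g) O) <= (q f + 1) * q (f - g).
Proof.
rewrite -(@ler_pXn2r _ 2) ?nnegrE ?nm_ge0 ?mulr_ge0 ?addr_ge0 ?rq_ge0//.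
rewrite nm_sqrB !nm_weyl_vec weyl_ip (rqBC _ g f).
have -> x (y : R) : complex.Re (expi x * y%:C%C) = cos x * y.
  by rewrite /= mulr0 subr0.
have d0 : 0 <= q (f - g) ^+ 2 / 4 by rewrite divr_ge0 ?sqr_ge0.
have h1 := cos_expR_ge (s f g / 2) d0.
have h2 : s f g ^+ 2 <= (q f * q (f - g)) ^+ 2.
  rewrite -(real_normK (num_real (s f g))) ler_pXn2r ?nnegrE ?mulr_ge0 ?rq_ge0//.
  have -> : s f g = - s f (f - g).
    by rewrite sDr s_self add0r (s_anti (- g) f) sNl opprK s_anti.
  by rewrite normrN.
have := rq_ge0 b f; have := rq_ge0 b (f - g).
move: h1 h2; rewrite !exprMn; set d := q _; set x := q f.
move: (s f g) (cos _ * _) => S T h1 h2 d_ge0 x_ge0.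
have : 0 <= x * d ^+ 2 by rewrite mulr_ge0 ?sqr_ge0.
have : 0 <= d ^+ 2 by rewrite sqr_ge0.
have : 0 <= x ^+ 2 * d ^+ 2 by rewrite mulr_ge0 ?sqr_ge0.
rewrite sqrrD expr1n mulr1 !mulrDl; lra.
Qed.

(** Both sides are linear and bounded in a, the right one by [rep_contract], so agreement on Weyl
    elements spreads by [weyl_ind]. *)
Lemma expectation_ext (w' : state A) (x : H) :
  (forall f, w' (W f) = h_inner x (p (W f) x)) ->
  forall a, w' a = h_inner x (p a x).
Proof.
move=> h; apply: weyl_ind => //.
- have := rep_linearl p x (-1) 0 0; rewrite scaler0 addr0 scaleN1r addNr => ->.
  by rewrite state0 (@ip0r _ (hilbert_pre H) x : h_inner x 0 = 0).
- by move=> c a a' Ea Ea'; rewrite state_linear rep_linearl h_innerL Ea Ea'.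
- move=> a ha; apply/subr0_eq/nm_eq0/eqP; rewrite eq_le nm_ge0 andbT.
  apply/ler_addgt0Pr => e e0; rewrite add0r.
  have k0 : 0 < 1 + nm x ^+ 2 by rewrite ltr_pwDl ?sqr_ge0.
  have [a' Ea' aa'] := ha _ (divr_gt0 e0 k0).
  have -> : w' a - h_inner x (p a x) =
      w' (a - a') - h_inner x (p (a - a') x).
    have -> : a - a' = -1 *: a' + a by rewrite scaleN1r addrC.
    rewrite state_linear rep_linearl h_innerL -Ea'; ring.
  apply: le_trans (nmD _ _) _; rewrite nmN.
  have h1 : nm (w' (a - a')) <= nm (a - a').
    by have := state_bounded w' (a - a'); rewrite !nmE lecR.
  have h2 : nm (h_inner x (p (a - a') x)) <= nm x ^+ 2 * nm (a - a').
    apply: le_trans (ip_norm_le _ _) _; rewrite expr2 -mulrA ler_wpM2l ?nm_ge0//.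
    by rewrite mulrC; exact: rep_contract.
  apply: le_trans (lerD h1 h2) _; rewrite -{1}[nm (a - a')]mul1r -mulrDl mulrC.
  by rewrite -ler_pdivlMr// ltW.
Qed.


Lemma weyl_cancel f : p (W (- f)) (p (W f) O) = O.
Proof.
rewrite -rep_mul weylM sNl s_self addNr oppr0 mul0r oppr0 expi0 scale1r.
(* It remains that W(0) fixes the cyclic vector: both vectors have norm 1 and their inner product
   has real part 1, so their distance is 0. *)
apply/subr0_eq/nm_eq0/eqP; rewrite -(@eqrXn2 _ 2) ?nm_ge0// expr0n nm_sqrB.
rewrite nm_weyl_vec.
have O1 : nm O ^+ 2 = 1.
  apply: complexI; rewrite rmorphXn /= -nmE -h_inner_norm -{2}[gns_vec G](gns_rep1 (gns_vec G)).
  by rewrite -gns_state state_one.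
rewrite O1 h_innerC -gns_state conjCE.
rewrite /= wW_Re rq0 expr0n /= mul0r oppr0 expR0.
by apply/eqP; ring.
Qed.

End in_gns.

(** Both GNS triples share space and representation and differ only in the cyclic vector, so the
    intertwiner is the identity. The functional l is merely a limit of the [s (h n)]; no element of
    V has to represent it. *)
Lemma translate_equivalent (w' : state A) (l : V -> R) (h : nat -> V)
    (e : nat -> R) : e @ \oo --> 0 ->
  (forall n m, q (h n - h m) <= e n + e m) ->
  (forall n f, `|s (h n) f - l f| <= e n * q f) ->
  (forall f, w' (W f) = w (W f) * expi (l f)) -> equivalent_states w' w.
Proof.
move=> e0 hC hl w'E; have [G _] := gns_ex w.
pose H := gns_space G; pose p := gns_rep G; pose O := gns_vec G.
have ege0 n : 0 <= e n by have := hC n n; rewrite subrr rq0; lra.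
pose psi n : H := p (W (h n)) O.
(* B bounds the factor [q (h n) + 1] of [weyl_vec_dist], so that the vectors inherit the Cauchy rate
   of the fields. *)
have [B B0 hB] : exists2 B, 0 <= B & forall n, q (h n) + 1 <= B.
  have /cvg_seq_bounded [M [_ hM]] : cvg (e @ \oo) by apply/cvg_ex; exists 0.
  have M1 : M < `|M| + 1 by rewrite (le_lt_trans (ler_norm _)) ?ltrDl.
  exists (q (h 0%N) + e 0%N + (`|M| + 1) + 1).
    by rewrite !addr_ge0 ?rq_ge0.
  move=> n; rewrite lerD2r; have := rqD b (h n - h 0%N) (h 0%N); rewrite subrK.
  have := hC n 0%N; have := le_trans (ler_norm _) (hM _ M1 n I); lra.
have Be0 : (fun n => B * e n) @ \oo --> 0 by exact: cvg0Z.
have [Psi hPsi] : exists Psi, forall n, nm (psi n - Psi) <= B * e n.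
  apply: complete_rate => // n m; rewrite -mulrDr.
  apply: le_trans (weyl_vec_dist _ _ _) _.
  by apply: ler_pM; rewrite ?addr_ge0 ?rq_ge0.
have PsiE a : w' a = h_inner Psi (p a Psi).
  move: a; apply: expectation_ext => f; rewrite w'E.
  (* These expectations have two limits: convergence of the phases gives [w'], convergence of the
     vectors gives the expectation in Psi. *)
  pose z n := h_inner (psi n) (p (W f) (psi n)).
  have z1 : cto z (w (W f) * expi (l f)).
    exists (fun n => q f * e n); first exact: cvg0Z.
    move=> n; rewrite /z weyl_sandwich mulrC -mulrBr nmM.
    have w1 : nm (w (W f)) <= 1.
      rewrite wE nm_real ger0_norm ?expR_ge0// expR_le1 oppr_le0.
      by rewrite divr_ge0 ?sqr_ge0.
    apply: le_trans (_ : 1 * `|s (h n) f - l f| <= _).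
      by apply: ler_pM; rewrite ?nm_ge0 ?expi_dist.
    by rewrite mul1r mulrC.
  apply: cto_unique z1 _.
  exists (fun n => B * e n + nm Psi * (B * e n)).
    by apply: cvg0D => //; exact: cvg0Z.
  move=> n; have := @ip_dist_le _ (hilbert_pre H) (psi n) (p (W f) (psi n)) Psi (p (W f) Psi).
  rewrite !pn_hilbert_pre => /le_trans; apply.
  have W1 x : nm (p (W f) x) <= nm x.
    apply: le_trans (rep_contract _ _ _) _.
    by rewrite ler_piMl ?nm_ge0// nm_weyl.
  apply: lerD.
    rewrite -[leRHS]mulr1; apply: ler_pM; rewrite ?nm_ge0//.
    by apply: le_trans (W1 _) _; rewrite nm_weyl_vec.
  rewrite -repBr.
  by rewrite ler_wpM2l ?nm_ge0//; apply: le_trans (W1 _) _.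
have Psi_cyclic : closure [set p a Psi | a in setT] = setT.
  apply/seteqP; split=> // x _; apply/closureP => r r0.
  have : closure [set p a O | a in setT] x by rewrite gns_cyclic.
  have r2 : 0 < r / 2 by rewrite divr_gt0.
  move=> /closureP /(_ _ r2) [_ [a _ <-] xa].
  have a1 : 0 < nm a + 1 by rewrite ltr_wpDl ?nm_ge0.
  have [n hn] := cvg0_ex Be0 (divr_gt0 r2 a1).
  (* W(-h n) is a contraction and returns [psi n] to Omega, so it sends Psi close to Omega. *)
  exists (p (bs_mul a (W (- h n))) Psi); first by exists (bs_mul a (W (- h n))).
  apply: le_lt_trans (nm_distD (p a O) _ _) _.
  suff : nm (p a O - p (bs_mul a (W (- h n))) Psi) < r / 2.
    by move=> h2; rewrite (splitr r); exact: ltrD.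
  have -> : p a O - p (bs_mul a (W (- h n))) Psi =
      p (bs_mul a (W (- h n))) (psi n - Psi).
    by rewrite repBr !rep_mul weyl_cancel.
  rewrite rep_mul; apply: le_lt_trans (rep_contract _ _ _) _.
  have h1 : nm (p (W (- h n)) (psi n - Psi)) <= B * e n.
    apply: le_trans (rep_contract _ _ _) (le_trans _ (hPsi n)).
    by rewrite ler_piMl ?nm_ge0// nm_weyl.
  apply: le_lt_trans (ler_wpM2l (nm_ge0 a) h1) _.
  move: hn; rewrite ltr_pdivlMr//; apply: le_lt_trans.
  by rewrite mulrC ler_wpM2l ?lerDl// mulr_ge0.
exists (Gns PsiE Psi_cyclic), G, id; split=> //.
by exists id.
Qed.

(** The operators are contractions, so by [Tclose] convergence only has to be checked on the vectors
    W(g) Omega. There the expectation is exp(i s(g, f n)) times a Gaussian, and both factors tend to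
    1. *)
Lemma weyl_strong_cvg (G : gns w) (f : nat -> V) (x : gns_space G) :
  (fun n => q (f n)) @ \oo --> 0 ->
  (fun n => nm (gns_rep G (W (f n)) x - x)) @ \oo --> 0.
Proof.
move=> f0; set p := gns_rep G; set v := gns_vec G.
pose T n := p (W (f n)).
have T1 n y : nm (T n y) <= nm y.
  by apply: le_trans (rep_contract _ _ _) _; rewrite ler_piMl ?nm_ge0// nm_weyl.
have Tclose n (y z : gns_space G) :
    nm (T n y - y) <= nm (T n z - z) + 2 * nm (y - z).
  have -> : T n y - y = T n (y - z) + (T n z - z) - (y - z).
    by rewrite /T repBr addrA subrK opprB addrA subrK.
  apply: le_trans (nmD _ _) _; rewrite nmN.
  by have := nmD (T n (y - z)) (T n z - z); have := T1 n (y - z); lra.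
have vP a : (fun n => nm (T n (p a v) - p a v)) @ \oo --> 0.
  move: a; apply: weyl_ind.
  - rewrite /p rep0l; under eq_fun do rewrite subr0.
    apply: cvg0_squeeze (cvg_cst 0) _ => n; rewrite nm_ge0 /=.
    by have := T1 n 0; rewrite nm0.
  - move=> c a a' ha ha'.
    apply: cvg0_squeeze (cvg0D (cvg0Z (nm c) ha) ha') _ => n; rewrite nm_ge0 /=.
    rewrite /p rep_linearl /T rep_linear opprD addrACA -scalerBr.
    by apply: le_trans (nmD _ _) _; rewrite nmZ.
  - move=> g; apply: cvg0_squeeze (cvg0Z (q g + 1) f0) _ => n; rewrite nm_ge0 /=.
    rewrite -(@ler_pXn2r _ 2) ?nnegrE ?nm_ge0 ?mulr_ge0 ?addr_ge0 ?rq_ge0//.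
    rewrite nmBC nm_sqrB [X in complex.Re X]weyl_sandwich wE.
    have -> u (y : R) : complex.Re (expi u * y%:C%C) = cos u * y.
      by rewrite /= mulr0 subr0.
    have d0 : 0 <= q (f n) ^+ 2 / 4 by rewrite divr_ge0 ?sqr_ge0.
    have h1 := cos_expR_ge (s g (f n)) d0.
    have h2 : nm (T n (p (W g) v)) ^+ 2 <= 1.
      rewrite expr_le1 ?nm_ge0//; apply: le_trans (T1 _ _) _.
      by rewrite nm_weyl_vec.
    have h3 : s g (f n) ^+ 2 <= (q g * q (f n)) ^+ 2.
      rewrite -(real_normK (num_real (s g (f n)))).
      by rewrite ler_pXn2r ?nnegrE ?mulr_ge0 ?rq_ge0.
    rewrite nm_weyl_vec expr1n.
    have := rq_ge0 b g; have := rq_ge0 b (f n).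
    move: h1 h2 h3; rewrite !exprMn -/p -/v; set d := q (f n); set k := q g.
    move: (s g (f n)) (cos _ * _) (nm _ ^+ 2) => S C N h1 h2 h3 d_ge0 k_ge0.
    have : 0 <= k * d ^+ 2 by rewrite mulr_ge0 ?sqr_ge0.
    have : 0 <= d ^+ 2 by rewrite sqr_ge0.
    rewrite sqrrD expr1n mulr1 !mulrDl; lra.
  - move=> a ha; apply: cvg0_approx => [n|e e0]; first exact: nm_ge0.
    have k0 : 0 < 2 * (nm v + 1) by rewrite mulr_gt0// ltr_wpDl ?nm_ge0.
    have [a' Ha' aa'] := ha _ (divr_gt0 e0 k0).
    exists (fun n => nm (T n (p a' v) - p a' v)) => // n.
    apply: le_trans (Tclose n _ (p a' v)) _; rewrite lerD2l.
    rewrite -repBl; apply: le_trans (ler_wpM2l _ (rep_contract p _ _)) _ => //.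
    move: aa'; rewrite ltr_pdivlMr// => /ltW; apply: le_trans.
    rewrite mulrCA ler_wpM2l ?nm_ge0// ler_wpM2l// lerDl//.
apply: cvg0_approx => [n|e e0]; first exact: nm_ge0.
have : closure [set p a v | a in setT] x by rewrite gns_cyclic.
have e2 : 0 < e / 2 by rewrite divr_gt0.
move=> /closureP /(_ _ e2) [_ [a _ <-] xa].
exists (fun n => nm (T n (p a v) - p a v)) => // n.
by apply: le_trans (Tclose n _ (p a v)) _; lra.
Qed.

Lemma sharp_inequivalent (w' : state A) (l : V -> R) (f : nat -> V) :
  (fun n => q (f n)) @ \oo --> 0 -> (forall n, expi (l (f n)) = - 1) ->
  (forall f, w' (W f) = w (W f) * expi (l f)) -> ~ equivalent_states w' w.
Proof.
move=> f0 lf w'E [G' [G [u [ulin ubij uip ucomm]]]].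
pose x := u (gns_vec G').
have xE a : w' a = h_inner x (gns_rep G a x) by rewrite (gns_state G') -ucomm uip.
have h1 : cto (fun n => w' (W (f n))) (h_inner x x).
  exists (fun n => nm x * nm (gns_rep G (W (f n)) x - x)).
    by apply: cvg0Z; exact: weyl_strong_cvg.
  move=> n; rewrite xE.
  have <- := @ipBr _ (hilbert_pre (gns_space G)) x (gns_rep G (W (f n)) x) x.
  exact: ip_norm_le.
have h2 : cto (fun n => w' (W (f n))) (- 1).
  exists (fun n => q (f n) * q (f n)).
    by rewrite -[X in _ --> X](mul0r 0); exact: cvgM.
  move=> n; rewrite w'E lf wE mulrN1 opprK addrC -[1]/(1%:C%C) -rmorphB nm_real.
  have := expR_ge1Dx (- (q (f n) ^+ 2 / 4)).
  have : expR (- (q (f n) ^+ 2 / 4)) <= 1.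
    by rewrite expR_le1 oppr_le0 divr_ge0 ?sqr_ge0.
  have := sqr_ge0 (q (f n)); rewrite expr2.
  by move=> ? ? ?; rewrite ger0_norm; lra.
have := h_inner_ge0 x; rewrite (cto_unique h1 h2).
by rewrite lerNr oppr0 ler10.
Qed.

End fock_states.

(** * Smooth functions on SU(2)^n *)

Section continuous_real.
Context {R : realType} {T : topologicalType}.
Implicit Types F G : T -> R.

Lemma continuous_addR F G : continuous F -> continuous G ->
  continuous (fun x => F x + G x : R).
Proof. by move=> cF cG x; apply: cvgD; [exact: cF|exact: cG]. Qed.

Lemma continuous_mulR F G : continuous F -> continuous G ->
  continuous (fun x => F x * G x : R).
Proof. by move=> cF cG x; apply: cvgM; [exact: cF|exact: cG]. Qed.

Lemma continuous_oppR F : continuous F -> continuous (fun x => - F x : R).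
Proof. by move=> cF x; apply: cvgN; exact: cF. Qed.

Lemma continuous_cstR (c : R) : continuous (fun _ : T => c).
Proof. by move=> x; exact: cvg_cst. Qed.

Lemma continuous_expnR F m : continuous F -> continuous (fun x => F x ^+ m : R).
Proof.
move=> cF; elim: m => [|m IH].
  by under eq_fun do rewrite expr0; exact: continuous_cstR.
by under eq_fun do rewrite exprS; exact: continuous_mulR.
Qed.

End continuous_real.

(** * Coordinates and compactness of SU(2)^n *)

Section su2_coordinates.
Context {R : realType} {n : nat}.

Definition cre (X : 'M[R]_(n, 2 * 2 + 2 * 2)) i (a b : 'I_2) : R :=
  X i (lshift (2 * 2) (mxvec_index a b)).
Definition cim (X : 'M[R]_(n, 2 * 2 + 2 * 2)) i (a b : 'I_2) : R :=
  X i (rshift (2 * 2) (mxvec_index a b)).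

Lemma cre_coord (x : SU2n R n) i a b :
  cre (SU2n_coord x) i a b = complex.Re (x i a b).
Proof. by rewrite /cre mxE row_mxEl mxvecE mxE. Qed.

Lemma cim_coord (x : SU2n R n) i a b :
  cim (SU2n_coord x) i a b = complex.Im (x i a b).
Proof. by rewrite /cim mxE row_mxEr mxvecE mxE. Qed.

Lemma coord_ext (X Y : 'M[R]_(n, 2 * 2 + 2 * 2)) :
  (forall i a b, cre X i a b = cre Y i a b /\ cim X i a b = cim Y i a b) ->
  X = Y.
Proof.
move=> h; apply/matrixP => i j; rewrite -[j]fintype.splitK.
by case: (fintype.split j) => k /=; case/mxvec_indexP: k => a b; have [] := h i a b.
Qed.

(** Unitarity and determinant 1, split into real and imaginary parts. As polynomial equations they
    show that the image of the coordinates is closed, and they allow a group element to be rebuilt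
    from its coordinates. *)
Definition su2_eqs (r m : 'I_2 -> 'I_2 -> R) := [/\
  forall a c, r a 0 * r c 0 + m a 0 * m c 0 + (r a 1 * r c 1 + m a 1 * m c 1)
    = (a == c)%:R,
  forall a c, m a 0 * r c 0 - r a 0 * m c 0 + (m a 1 * r c 1 - r a 1 * m c 1)
    = 0,
  r 0 0 * r 1 1 - m 0 0 * m 1 1 - (r 0 1 * r 1 0 - m 0 1 * m 1 0) = 1 &
  r 0 0 * m 1 1 + m 0 0 * r 1 1 - (r 0 1 * m 1 0 + m 0 1 * r 1 0) = 0].

Lemma su2_eqsP (M : 'M[R[i]]_2) :
  reflect (su2_eqs (fun a b => complex.Re (M a b)) (fun a b => complex.Im (M a b)))
          ((M \is unitarymx) && (\det M == 1)).
Proof.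
have sum2 (F : 'I_2 -> R[i]) : \sum_(k < 2) F k = F 0 + F 1.
  rewrite big_ord_recl big_ord1; congr (_ + F _); exact: val_inj.
have detE : \det M = M 0 0 * M 1 1 - M 0 1 * M 1 0.
  rewrite (expand_det_row _ 0) sum2 /cofactor !det_mx11 !mxE /=.
  rewrite addn0 add0n expr0 expr1 mul1r mulN1r mulrN.
  by congr (_ * M _ _ - _ * M _ _); exact: val_inj.
apply: (iffP andP).
  move=> [/unitarymxP /matrixP MU /eqP]; rewrite detE => Md; split.
  - move=> a c; have := MU a c; rewrite !mxE sum2 !mxE !conjCE.
    move=> /(congr1 (@complex.Re R)); rewrite /=.
    have -> : complex.Re ((a == c)%:R : R[i]) = (a == c)%:R by case: (a == c).
    by move=> <-; case: (M a 0) (M c 0) (M a 1) (M c 1) => ? ? [? ?] [? ?] [? ?] /=; ring.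
  - move=> a c; have := MU a c; rewrite !mxE sum2 !mxE !conjCE.
    move=> /(congr1 (@complex.Im R)); rewrite /=.
    have -> : complex.Im ((a == c)%:R : R[i]) = 0 by case: (a == c).
    by move=> <-; case: (M a 0) (M c 0) (M a 1) (M c 1) => ? ? [? ?] [? ?] [? ?] /=; ring.
  - move: Md => /(congr1 (@complex.Re R)) /= <-.
    by case: (M 0 0) (M 0 1) (M 1 0) (M 1 1) => ? ? [? ?] [? ?] [? ?] /=; ring.
  - move: Md => /(congr1 (@complex.Im R)) /= <-.
    by case: (M 0 0) (M 0 1) (M 1 0) (M 1 1) => ? ? [? ?] [? ?] [? ?] /=; ring.
move=> [h1 h2 h3 h4]; split.
  apply/unitarymxP/matrixP => a c; rewrite !mxE sum2 !mxE !conjCE.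
  apply/eqP; rewrite eq_complex.
  have -> : complex.Re ((a == c)%:R : R[i]) = (a == c)%:R by case: (a == c).
  have -> : complex.Im ((a == c)%:R : R[i]) = 0 by case: (a == c).
  have := h1 a c; have := h2 a c.
  case: (M a 0) (M c 0) (M a 1) (M c 1) => ? ? [? ?] [? ?] [? ?] /= e1 e2.
  by apply/andP; split; apply/eqP; [rewrite -e2|rewrite -e1]; ring.
rewrite detE eq_complex; move: h3 h4.
case: (M 0 0) (M 0 1) (M 1 0) (M 1 1) => ? ? [? ?] [? ?] [? ?] /= e1 e2.
by apply/andP; split; apply/eqP; [rewrite -e1|rewrite -e2]; ring.
Qed.

Lemma SU2_eqs (g : SU2 R) :
  su2_eqs (fun a b => complex.Re (g a b)) (fun a b => complex.Im (g a b)).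
Proof. by apply/su2_eqsP; exact: su2P. Qed.

Lemma range_SU2n_coord :
  range (@SU2n_coord R n) = [set X | forall i, su2_eqs (cre X i) (cim X i)].
Proof.
apply/seteqP; split=> [_ [x _ <-] i|X h].
  have := SU2_eqs (x i).
  by congr su2_eqs; apply/funext => a; apply/funext => c;
    rewrite (cre_coord, cim_coord).
have M i : {g : SU2 R | forall a b,
    complex.Re (g a b) = cre X i a b /\ complex.Im (g a b) = cim X i a b}.
  pose g : 'M[R[i]]_2 := \matrix_(a, b) (cre X i a b +i* cim X i a b)%C.
  have gP : (g \is unitarymx) && (\det g == 1).
    apply/su2_eqsP; have := h i.
    by congr su2_eqs; apply/funext => a; apply/funext => c; rewrite mxE.
  by exists (MkSU2 gP) => a b; rewrite /= mxE.
exists [ffun i => projT1 (M i)] => //.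
apply: coord_ext => i a c; rewrite cre_coord cim_coord ffunE.
by case: (M i).
Qed.

Lemma su2_eqs_le1 (r m : 'I_2 -> 'I_2 -> R) a c : su2_eqs r m ->
  `|r a c| <= 1 /\ `|m a c| <= 1.
Proof.
move=> [h _ _ _]; have := h a a; rewrite eqxx mulr1n -!expr2.
have sq (u : R) : u ^+ 2 <= 1 -> `|u| <= 1.
  by rewrite -(real_normK (num_real u)) expr_le1.
have cE : c = 0 \/ c = 1.
  by case: c => -[|[|//]] ?; [left|right]; exact: val_inj.
have := sqr_ge0 (r a 0); have := sqr_ge0 (r a 1).
have := sqr_ge0 (m a 0); have := sqr_ge0 (m a 1).
by case: cE => -> *; split; apply: sq; lra.
Qed.

Lemma closed_range_SU2n_coord : closed (range (@SU2n_coord R n)).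
Proof.
rewrite range_SU2n_coord; set E := [set X | _] => X cX.
have key (F : 'M[R]_(n, 2 * 2 + 2 * 2) -> R) (k : R) : continuous F ->
    (forall Y, E Y -> F Y = k) -> F X = k.
  move=> cF EF; have clF : closed (F @^-1` [set k]).
    by move/continuous_closedP : cF; apply; exact: closed_eq.
  have EF' : E `<=` F @^-1` [set k] by move=> Y /EF.
  exact: clF (closureS EF' cX).
have cr i a c : continuous (fun X => cre X i a c) by exact: coord_continuous.
have cm i a c : continuous (fun X => cim X i a c) by exact: coord_continuous.
have rr i a b c d := continuous_mulR (cr i a b) (cr i c d).
have rm i a b c d := continuous_mulR (cr i a b) (cm i c d).
have mr i a b c d := continuous_mulR (cm i a b) (cr i c d).
have mm i a b c d := continuous_mulR (cm i a b) (cm i c d).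
move=> i; split=> [a c|a c||].
- apply: (key (fun Y => cre Y i a 0 * cre Y i c 0 + cim Y i a 0 * cim Y i c 0 +
    (cre Y i a 1 * cre Y i c 1 + cim Y i a 1 * cim Y i c 1))); last first.
    by move=> Y /(_ i) [].
  exact: continuous_addR
    (continuous_addR (rr _ _ _ _ _) (mm _ _ _ _ _))
    (continuous_addR (rr _ _ _ _ _) (mm _ _ _ _ _)).
- apply: (key (fun Y => cim Y i a 0 * cre Y i c 0 - cre Y i a 0 * cim Y i c 0 +
    (cim Y i a 1 * cre Y i c 1 - cre Y i a 1 * cim Y i c 1))); last first.
    by move=> Y /(_ i) [].
  exact: continuous_addR
    (continuous_addR (mr _ _ _ _ _) (continuous_oppR (rm _ _ _ _ _)))
    (continuous_addR (mr _ _ _ _ _) (continuous_oppR (rm _ _ _ _ _))).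
- apply: (key (fun Y => cre Y i 0 0 * cre Y i 1 1 - cim Y i 0 0 * cim Y i 1 1 -
    (cre Y i 0 1 * cre Y i 1 0 - cim Y i 0 1 * cim Y i 1 0))); last first.
    by move=> Y /(_ i) [].
  exact: continuous_addR
    (continuous_addR (rr _ _ _ _ _) (continuous_oppR (mm _ _ _ _ _)))
    (continuous_oppR (continuous_addR (rr _ _ _ _ _) (continuous_oppR (mm _ _ _ _ _)))).
- apply: (key (fun Y => cre Y i 0 0 * cim Y i 1 1 + cim Y i 0 0 * cre Y i 1 1 -
    (cre Y i 0 1 * cim Y i 1 0 + cim Y i 0 1 * cre Y i 1 0))); last first.
    by move=> Y /(_ i) [].
  exact: continuous_addR
    (continuous_addR (rm _ _ _ _ _) (mr _ _ _ _ _))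
    (continuous_oppR (continuous_addR (rm _ _ _ _ _) (mr _ _ _ _ _))).
Qed.

(** The coordinate image is closed and lies in a cube. A cluster point there lifts to M because the
    topology of M is initial for the coordinates. *)
Lemma SU2n_compact : compact [set: SU2n R n].
Proof.
pose f (v : 'rV[R]_(n * (2 * 2 + 2 * 2))) : 'M[R]_(n, 2 * 2 + 2 * 2) := vec_mx v.
have fc : continuous f.
  move=> v A /nbhs_ballP [r r0 rA]; apply/nbhs_ballP; exists r => // u [_ uv].
  apply: rA; split=> // i j; rewrite /f !mxE.
  exact: uv.
have cbox : compact (f @` [set v : 'rV[R]_(n * (2 * 2 + 2 * 2)) |
      forall i, `[-1, 1]%classic (v ord0 i)]).
  apply: continuous_compact; first exact: continuous_subspaceT.
  by apply: (@rV_compact R _ (fun=> `[-1, 1]%classic)) => _; exact: segment_compact.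
have cK : compact (range (@SU2n_coord R n)).
  apply: subclosed_compact closed_range_SU2n_coord cbox _.
  rewrite range_SU2n_coord => X h; exists (mxvec X); last exact: mxvecK.
  move=> k; case/mxvec_indexP: k => i j; rewrite mxvecE.
  rewrite -[j]fintype.splitK /= in_itv /= -ler_norml.
  by case: (fintype.split j) => k; case/mxvec_indexP: k => a c;
    have [] := su2_eqs_le1 a c (h i).
move=> F FF _.
have FK : (@SU2n_coord R n @ F) (range (@SU2n_coord R n)).
  by apply: (@filterS _ F _ setT) filterT => y _; exists y.
have [_ [[x _ <-] xF]] := cK _ _ FK; exists x; split=> // A B FA xB.
have [C [[C' oC' CE] Cx CB]] := xB; rewrite -CE in Cx CB.
have nC' : nbhs (SU2n_coord x) C' by apply: open_nbhs_nbhs.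
have FcA : (@SU2n_coord R n @ F) (@SU2n_coord R n @` A).
  by apply: (@filterS _ F _ A) FA => y Ay; exists y.
have [_ [[y Ay <-] C'y]] := xF _ _ FcA nC'.
by exists y; split => //; apply: CB.
Qed.

End su2_coordinates.

(** * Integration of continuous functions against a probability on SU(2)^n *)

Section continuous_integrable.
Context {R : realType} {n : nat}.
Implicit Types g h : SU2n R n -> R.

Lemma smooth_continuous g : smooth_fun g -> continuous g.
Proof.
move=> sg x; have [F [/(_ 0%N) [cF _] gF]] := sg x.
have cFx : (F \o @SU2n_coord R n) @ x --> F (SU2n_coord x).
  by apply: continuous_comp; [exact: initial_continuous|exact: cF].
have gx : g x = F (SU2n_coord x) := nbhs_singleton gF.
suff : g @ x --> F (SU2n_coord x) by rewrite -gx.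
apply: cvg_trans cFx; apply: near_eq_cvg.
  exact: (@nbhs_filter (SU2n R n)).
by near=> y; rewrite /= (near gF y).
Unshelve. all: by end_near.
Qed.

Lemma open_measurable_SU2n (A : set (SU2n R n)) : open A -> measurable A.
Proof. by move=> oA; apply: sub_sigma_algebra. Qed.

Lemma continuous_measurable_SU2n g : continuous g -> measurable_fun setT g.
Proof.
move=> /continuousP cg; apply: (measurability _ (measurable_realfun.RGenOpens.measurableE R)).
move=> _ [_ [a [b ->] <-]]; rewrite setTI; apply: open_measurable_SU2n.
exact/cg/interval_open.
Qed.

Variable mu : probability (SU2n R n) R.

Lemma continuous_integrable_SU2n g (U : set (SU2n R n)) : measurable U ->
  continuous g -> mu.-integrable U (EFin \o g).
Proof.
move=> mU cg; apply: (@integrableS _ _ _ _ setT) => //.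
apply: measurable_bounded_integrable => //.
- by apply: le_lt_trans (probability_le1 mu measurableT) _; exact: ltry.
- exact: continuous_measurable_SU2n.
- have : compact (g @` setT).
    by apply: continuous_compact SU2n_compact; exact: continuous_subspaceT.
  move=> /compact_bounded [M [Mr hM]]; exists M; split => // k /hM h x _.
  by apply: h; exists x.
Qed.

Local Notation Int g := (\int[mu]_x g x).

Lemma Rintegral_lin (a : R) g h : continuous g -> continuous h ->
  Int (fun x => a * g x + h x) = a * Int g + Int h.
Proof.
move=> cg ch; have cag : continuous (fun x => a * g x).
  by apply: continuous_mulR => //; exact: continuous_cstR.
rewrite RintegralD//; try exact: continuous_integrable_SU2n.
by rewrite RintegralZl//; exact: continuous_integrable_SU2n.
Qed.

Lemma Rintegral_le g h : continuous g -> continuous h ->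
  (forall x, g x <= h x) -> Int g <= Int h.
Proof.
by move=> cg ch gh; apply: le_Rintegral => //; exact: continuous_integrable_SU2n.
Qed.

Lemma Rintegral_probability_cst (c : R) : \int[mu]_(x in setT) c = c.
Proof.
rewrite Rintegral_cst// [X in fine X](_ : _ = 1%E) ?mulr1//.
exact: probability_setT.
Qed.

(** The domain is first enlarged to M for |g|. Then Cauchy-Schwarz against the constant 1 is the
    discriminant of the integral of [(|g| + t)^2], which uses total mass 1. *)
Lemma Rintegral_sqr_le g (U : set (SU2n R n)) : measurable U -> continuous g ->
  `|\int[mu]_(x in U) g x| ^+ 2 <= Int (fun x => g x ^+ 2).
Proof.
move=> mU cg; have cng : continuous (fun x => `|g x|).
  by move=> x; apply: continuous_comp; [exact: cg|exact: norm_continuous].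
have cg2 : continuous (fun x => g x ^+ 2).
  exact: continuous_expnR.
have ccst (c : R) : continuous (fun _ : SU2n R n => c) by exact: continuous_cstR.
apply: (@le_trans _ _ (Int (fun x => `|g x|) ^+ 2)).
  rewrite ler_pXn2r ?nnegrE//; last by apply: Rintegral_ge0.
  apply: le_trans (le_normr_Rintegral mU (continuous_integrable_SU2n mU cg)) _.
  have ig V (mV : measurable V) := integrable_fin_num mV (continuous_integrable_SU2n mV cng).
  rewrite /Rintegral fine_le ?ig//.
  apply: ge0_subset_integral => //.
  exact: measurable_int (continuous_integrable_SU2n measurableT cng).
rewrite -[leRHS]mulr1; apply: discr_le => //.
  by apply: Rintegral_ge0 => x _; rewrite sqr_ge0.
move=> t; have -> : Int (fun x => g x ^+ 2) + 2 * t * Int (fun x => `|g x|) + t ^+ 2 * 1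
    = Int (fun x => (`|g x| + t) ^+ 2).
  rewrite mulr1 -{1}(Rintegral_probability_cst (t ^+ 2)) -addrA -Rintegral_lin//.
  have c2 : continuous (fun x => 2 * t * `|g x| + t ^+ 2).
    by apply: continuous_addR => //; apply: continuous_mulR.
  rewrite -[X in X + _]mul1r -Rintegral_lin//; congr (Rintegral _ _ _).
  apply/funext => x; rewrite sqrrD real_normK ?num_real// mul1r; ring.
by apply: Rintegral_ge0 => x _; rewrite sqr_ge0.
Qed.

End continuous_integrable.

Lemma gauge_mono (S : field_space) (Q Q' : Prop) : (Q -> Q') ->
  (if S is gauge_invariant then Q else True) ->
  if S is gauge_invariant then Q' else True.
Proof. by case: S. Qed.

(** * The real and symplectic L^2-forms on fields, and means over open sets *)

Section field_form.
Context {R : realType} {n : nat} {S : field_space}.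
Implicit Types f g h : smooth_field R n S.

Definition fre f (x : SU2n R n) : R := complex.Re (f x).
Definition fim f (x : SU2n R n) : R := complex.Im (f x).

Lemma fre_continuous f : continuous (fre f).
Proof.
by apply: smooth_continuous; have /asboolP[] := Defs.fieldP f.
Qed.

Lemma fim_continuous f : continuous (fim f).
Proof.
by apply: smooth_continuous; have /asboolP[] := Defs.fieldP f.
Qed.

Lemma fieldE (c : R) f g x :
  fre (c *: f + g) x = c * fre f x + fre g x /\
  fim (c *: f + g) x = c * fim f x + fim g x.
Proof.
have E : (c *: f + g) x = c *: (f x : Rcomplex R) + g x by [].
by rewrite /fre /fim E; case: (f x) (g x) => [? ?] [? ?].
Qed.

Lemma field_ext f g : (forall x, fre f x = fre g x) ->
  (forall x, fim f x = fim g x) -> f = g.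
Proof.
move=> re im; apply/val_inj/funext => x; apply/eqP; rewrite eq_complex.
by apply/andP; split; apply/eqP; [exact: re|exact: im].
Qed.

Lemma fieldJ_subproof f :
  (fun x => (- fim f x +i* fre f x)%C : Rcomplex R) \in @smooth_fields R n S.
Proof.
have /asboolP[f1 f2 fg] := Defs.fieldP f; apply/asboolP; split => //.
  have := smooth_fun_lin (-1) f2 (smooth_fun_cst 0).
  by congr smooth_fun; apply/funext => x /=; rewrite mulN1r addr0.
by apply: gauge_mono fg => fg x h; rewrite /fre /fim /= fg.
Qed.

(** Multiplication by i. By [L2sympJ] it turns the symplectic form into the real inner product, so
    that Riesz sequences for [L2form] serve [L2symp]. *)
Definition fieldJ f : smooth_field R n S := MkField (fieldJ_subproof f).

Lemma fre_J f x : fre (fieldJ f) x = - fim f x. Proof. by []. Qed.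
Lemma fim_J f x : fim (fieldJ f) x = fre f x. Proof. by []. Qed.

Lemma fieldJL (c : R) f g : fieldJ (c *: f + g) = c *: fieldJ f + fieldJ g.
Proof.
by apply: field_ext => x; have [e1 e2] := fieldE c f g x;
  have [e3 e4] := fieldE c (fieldJ f) (fieldJ g) x;
  rewrite ?e3 ?e4 ?fre_J ?fim_J ?e1 ?e2 ?fre_J; ring.
Qed.

Variable mu : probability (SU2n R n) R.

Local Notation Int g := (\int[mu]_x g x).

Lemma L2inner_ReE f g : complex.Re (L2inner mu f g) =
  Int (fun x => fre f x * fre g x + fim f x * fim g x).
Proof.
rewrite /L2inner /Cintegral /=; congr (Rintegral _ _ _); apply/funext => x.
by rewrite conjCE /fre /fim; case: (f x) (g x) => [? ?] [? ?] /=; ring.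
Qed.

Lemma L2inner_ImE f g : complex.Im (L2inner mu f g) =
  Int (fun x => fre f x * fim g x - fim f x * fre g x).
Proof.
rewrite /L2inner /Cintegral /=; congr (Rintegral _ _ _); apply/funext => x.
by rewrite conjCE /fre /fim; case: (f x) (g x) => [? ?] [? ?] /=; ring.
Qed.

Lemma ip_continuous f g :
  continuous (fun x => fre f x * fre g x + fim f x * fim g x : R).
Proof.
exact: (continuous_addR (continuous_mulR (@fre_continuous f) (@fre_continuous g))
  (continuous_mulR (@fim_continuous f) (@fim_continuous g))).
Qed.

Lemma L2inner_ReL f (c : R) g h : complex.Re (L2inner mu f (c *: g + h)) =
  c * complex.Re (L2inner mu f g) + complex.Re (L2inner mu f h).
Proof.
rewrite !L2inner_ReE -Rintegral_lin; try exact: ip_continuous.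
congr (Rintegral _ _ _); apply/funext => x.
by have [-> ->] := fieldE c g h x; ring.
Qed.

Lemma L2inner_ReC f g : complex.Re (L2inner mu f g) = complex.Re (L2inner mu g f).
Proof.
rewrite !L2inner_ReE; congr (Rintegral _ _ _); apply/funext => x; ring.
Qed.

Lemma L2inner_Re_ge0 f : 0 <= complex.Re (L2inner mu f f).
Proof.
rewrite L2inner_ReE; apply: Rintegral_ge0 => x _.
by rewrite -!expr2 addr_ge0 ?sqr_ge0.
Qed.

Definition L2form : real_form (smooth_field R n S) :=
  RealForm L2inner_ReL L2inner_ReC L2inner_Re_ge0.

Lemma L2formE f g :
  L2form f g = Int (fun x => fre f x * fre g x + fim f x * fim g x).
Proof. exact: L2inner_ReE. Qed.

Lemma L2sympJ f g : L2symp mu f g = L2form (fieldJ f) g.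
Proof.
rewrite /L2symp L2formE L2inner_ImE; congr (Rintegral _ _ _).
by apply/funext => x; rewrite fre_J fim_J; ring.
Qed.

Lemma rqJ f : rq L2form (fieldJ f) = rq L2form f.
Proof.
rewrite /rq !L2formE; congr (Num.sqrt (Rintegral _ _ _)).
by apply/funext => x; rewrite fre_J fim_J; ring.
Qed.

Lemma L2symp_anti f g : L2symp mu g f = - L2symp mu f g.
Proof.
rewrite !L2sympJ !L2formE.
transitivity (-1 * Int (fun x => fre (fieldJ f) x * fre g x + fim (fieldJ f) x * fim g x)
  + Int (fun=> 0)); last by rewrite Rintegral_probability_cst addr0 mulN1r.
rewrite -Rintegral_lin; [|exact: ip_continuous|exact: continuous_cstR].
by congr (Rintegral _ _ _); apply/funext => x; rewrite !(fre_J, fim_J); ring.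
Qed.

Lemma L2symp_Dl f g h :
  L2symp mu (f + g) h = L2symp mu f h + L2symp mu g h.
Proof.
by rewrite L2symp_anti L2sympJ rfDr opprD -!L2sympJ -!L2symp_anti.
Qed.

Lemma L2symp_le f g : `|L2symp mu f g| <= rq L2form f * rq L2form g.
Proof. by rewrite L2sympJ -(rqJ f); exact: rf_le. Qed.

Definition mean_re (U : set (SU2n R n)) f : R := complex.Re (Cmean mu U f).

Lemma mean_reE U f :
  mean_re U f = (fine (mu U))^-1 * \int[mu]_(x in U) fre f x.
Proof. by rewrite /mean_re /Cmean /Cintegral /= mul0r subr0. Qed.

Lemma mean_reL U (c : R) f g : measurable U ->
  mean_re U (c *: f + g) = c * mean_re U f + mean_re U g.
Proof.
move=> mU; rewrite !mean_reE.
have i h : mu.-integrable U (EFin \o fre h).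
  exact: continuous_integrable_SU2n mU (@fre_continuous h).
have ic : mu.-integrable U (EFin \o (fun x => c * fre f x)).
  have cc : continuous (fun x => c * fre f x : R).
    by apply: continuous_mulR; [exact: continuous_cstR|exact: fre_continuous].
  exact: continuous_integrable_SU2n mU cc.
have -> : fre (c *: f + g) = fun x => c * fre f x + fre g x.
  by apply/funext => x; have [] := fieldE c f g x.
by rewrite RintegralD// RintegralZl//; ring.
Qed.

Lemma mean_re_le U f : measurable U ->
  `|mean_re U f| <= (fine (mu U))^-1 * rq L2form f.
Proof.
move=> mU; rewrite mean_reE normrM ger0_norm ?invr_ge0 ?fine_ge0//.
rewrite ler_wpM2l ?invr_ge0 ?fine_ge0//.
rewrite -(@ler_pXn2r _ 2) ?nnegrE ?rq_ge0// rq_sqr L2formE.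
apply: le_trans (Rintegral_sqr_le mu mU (@fre_continuous f)) _.
apply: Rintegral_le => [||x].
- exact: continuous_expnR 2 (@fre_continuous f).
- exact: ip_continuous.
- by rewrite expr2 lerDl -expr2 sqr_ge0.
Qed.

Lemma mean_approx U : measurable U ->
  exists (h : nat -> smooth_field R n S) (e : nat -> R),
  [/\ e @ \oo --> 0,
    forall k m, rq L2form (h k - h m) <= e k + e m &
    forall k f, `|L2symp mu (h k) f - Num.sqrt 2 * mean_re U f| <=
      e k * rq L2form f].
Proof.
(* The sign compensates for two multiplications by i: one in [fieldJ (h k)], one in [L2sympJ]. *)
move=> mU; pose l f := - (Num.sqrt 2 * mean_re U f).
have [c f g|f|h [e [e0 he hl]]] :=
    @riesz_approx _ _ L2form l (Num.sqrt 2 * (fine (mu U))^-1).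
- by rewrite /l mean_reL//; ring.
- rewrite /l normrN normrM ger0_norm ?sqrtr_ge0// -mulrA.
  by rewrite ler_wpM2l ?sqrtr_ge0// mean_re_le.
exists (fun k => fieldJ (h k)), e; split=> // [k m|k f].
  have -> : fieldJ (h k) - fieldJ (h m) = fieldJ (h k - h m).
    have := fieldJL (-1) (h m) (h k); rewrite !scaleN1r.
    by rewrite (addrC (- h m)) (addrC (- fieldJ _)).
  by rewrite rqJ.
have -> : L2symp mu (fieldJ (h k)) f = - L2form (h k) f.
  rewrite L2sympJ !L2formE.
  transitivity (-1 * Int (fun x => fre (h k) x * fre f x + fim (h k) x * fim f x)
    + Int (fun=> 0)); last by rewrite Rintegral_probability_cst addr0 mulN1r.
  rewrite -Rintegral_lin; [|exact: ip_continuous|exact: continuous_cstR].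
  by congr (Rintegral _ _ _); apply/funext => x; rewrite !(fre_J, fim_J); ring.
by rewrite -opprD normrN; have := hl k f; rewrite /l opprK.
Qed.

End field_form.

(** * Smoothness of polynomials in the coordinates *)

Section smooth_polynomials.
Context {R : realType} {E : normedModType R}.
Implicit Types F G : E -> R.

(** For the Leibniz rule, where F itself occurs next to its derivatives at the lower order. *)
Lemma is_CkW k F : is_Ck k.+1 F -> is_Ck k F.
Proof.
elim: k F => [|k IH] F [cF dF]; first by split.
by split=> // v; have [dv kv] := dF v; split => //; exact: IH.
Qed.

Lemma is_Ck_mul k F G : is_Ck k F -> is_Ck k G -> is_Ck k (fun x => F x * G x).
Proof.
elim: k F G => [|k IH] F G kF kG.
  by have [cF _] := kF; have [cG _] := kG; split=> //; exact: continuous_mulR.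
have kF' := is_CkW kF; have kG' := is_CkW kG.
have [cF dF] := kF; have [cG dG] := kG; split; first exact: continuous_mulR.
move=> v; have [dFv kFv] := dF v; have [dGv kGv] := dG v; split.
  by move=> x; exact: derivableM.
have -> : (fun x => 'D_v (fun x => F x * G x) x) =
    fun x => 1 * (F x * 'D_v G x) + G x * 'D_v F x.
  by apply/funext => x; rewrite mul1r (@deriveM _ _ F G).
by apply: is_Ck_lin; exact: IH.
Qed.

Lemma is_Ck_exp k F m : is_Ck k F -> is_Ck k (fun x => F x ^+ m).
Proof.
move=> kF; elim: m => [|m IH].
  by under eq_fun do rewrite expr0; exact: is_Ck_cst.
by under eq_fun do rewrite exprS; exact: is_Ck_mul.
Qed.

Lemma is_Ck_add k F G : is_Ck k F -> is_Ck k G -> is_Ck k (fun x => F x + G x).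
Proof.
by move=> kF kG; have := is_Ck_lin 1 kF kG; under eq_fun do rewrite mul1r.
Qed.

Lemma is_Ck_scale k (c : R) F : is_Ck k F -> is_Ck k (fun x => c * F x).
Proof.
move=> kF; have := is_Ck_lin c kF (@is_Ck_cst _ E k 0).
by under eq_fun do rewrite addr0.
Qed.

End smooth_polynomials.

Lemma is_Ck_coord {R : realType} m n k i j :
  is_Ck k (fun X : 'M[R]_(m, n) => X i j).
Proof.
case: k => [|k]; first by split=> //; exact: coord_continuous.
split; first exact: coord_continuous.
move=> v; split.
  by move=> X; apply: diff_derivable; exact: differentiable_coord.
have -> : (fun x => 'D_v (fun X : 'M[R]_(m, n) => X i j) x) = fun=> v i j.
  apply/funext => X; apply: cvg_lim => //.
  apply: (@cvg_trans _ ((fun=> v i j) @ (0 : R)^')); last exact: cvg_cst.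
  apply: near_eq_cvg; near=> h.
  have h0 : h != 0 by near: h; exact: nbhs_dnbhs_neq.
  by rewrite /= !mxE addrK /GRing.scale /= mulrA mulVf// mul1r.
exact: is_Ck_cst.
Unshelve. all: by end_near.
Qed.

(** * An infinite family of rotations in SU(2) *)

Section haar_null.
Context {R : realType}.

(* Rotations by the rational points of the circle, an infinite subset of SU(2). *)
Definition rot_mx (k : nat) : 'M[R[i]]_2 :=
  let p : R := (1 - k%:R ^+ 2) / (1 + k%:R ^+ 2) in
  let q : R := 2 * k%:R / (1 + k%:R ^+ 2) in
  \matrix_(a, b) (if a == b then p else if a == 0 then - q else q)%:C%C.

Lemma addr1_sqr_gt0 (k : nat) : 0 < 1 + k%:R ^+ 2 :> R.
Proof. by rewrite ltr_pwDl ?sqr_ge0. Qed.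

Lemma rot_mxP k : (rot_mx k \is unitarymx) && (\det (rot_mx k) == 1).
Proof.
have k0 : 1 + k%:R ^+ 2 != 0 :> R by rewrite gt_eqF ?addr1_sqr_gt0.
apply/su2_eqsP; split; rewrite ?mxE //=; first last.
- by field.
- by field.
- move=> a c; rewrite !mxE /=; ring.
move=> a c; rewrite !mxE /= !mulr0 !addr0.
have E (d : 'I_2) : d = 0 \/ d = 1.
  by case: d => -[|[|//]] ?; [left|right]; exact: val_inj.
by case: (E a) => ->; case: (E c) => -> /=; field.
Qed.

Definition rot k : SU2 R := MkSU2 (rot_mxP k).

Lemma rot_inj : injective rot.
Proof.
move=> k l /(congr1 (fun g : SU2 R => complex.Re (g 0 0))); rewrite /= !mxE /= => h.
have h2 : (k%:R : R) ^+ 2 = l%:R ^+ 2.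
  have nz m : 1 + m%:R ^+ 2 != 0 :> R by rewrite gt_eqF ?addr1_sqr_gt0.
  by move/eqP: h; rewrite eqr_div// => /eqP h3; lra.
have /eqP := h2; rewrite eqrXn2// eqr_nat => /eqP //.
Qed.

Lemma SU2_mul_cancel (g h y : SU2 R) : SU2_mul g y = SU2_mul h y -> g = h.
Proof.
move=> /(congr1 (@su2mx R)) /= E; apply/val_inj.
have /andP[yu _] := su2P y.
exact: (can_inj (mulmxK (unitarymx_unit yu))).
Qed.

End haar_null.

(** * A right-invariant squared distance on SU(2) *)

Section su2_distance.
Context {R : realType}.
Implicit Types g h k : SU2 R.

(** The Frobenius distance, squared so as to be polynomial in the coordinates. *)
Definition su2_dist g h : R := \sum_(a < 2) \sum_(b < 2)
  ((complex.Re (g a b) - complex.Re (h a b)) ^+ 2 +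
   (complex.Im (g a b) - complex.Im (h a b)) ^+ 2).

Lemma sum_ord2 (F : 'I_2 -> R) : \sum_(k < 2) F k = F 0 + F 1.
Proof. by rewrite big_ord_recl big_ord1; congr (_ + F _); exact: val_inj. Qed.

Lemma su2_dist_ge0 g h : 0 <= su2_dist g h.
Proof. by do 2![apply: sumr_ge0 => ? _]; rewrite addr_ge0 ?sqr_ge0. Qed.

Lemma su2_dist_le8 g h : su2_dist g h <= 8.
Proof.
have sq u v : (u - v) ^+ 2 <= 2 * (u * u) + 2 * (v * v) :> R.
  by have := sqr_ge0 (u + v); rewrite sqrrB sqrrD; lra.
have N k : \sum_(a < 2) \sum_(b < 2) (complex.Re (k a b) * complex.Re (k a b) +
    complex.Im (k a b) * complex.Im (k a b)) = 2.
  have [e _ _ _] := SU2_eqs k; have := e 0 0; have := e 1 1.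
  by rewrite !eqxx !mulr1n !sum_ord2 /=; lra.
pose T k a b := complex.Re (k a b) * complex.Re (k a b) +
  complex.Im (k a b) * complex.Im (k a b) : R.
(* Entrywise [(u - v)^2 <= 2 u^2 + 2 v^2], and an element of SU(2) has squared Frobenius norm 2. *)
have -> : 8 = 2 * (\sum_(a < 2) \sum_(b < 2) T g a b) +
    2 * (\sum_(a < 2) \sum_(b < 2) T h a b) by rewrite /T !N; ring.
rewrite !mulr_sumr -big_split /=; apply: ler_sum => a _.
rewrite !mulr_sumr -big_split /=; apply: ler_sum => b _.
have := sq (complex.Re (g a b)) (complex.Re (h a b)).
have := sq (complex.Im (g a b)) (complex.Im (h a b)); rewrite /T; lra.
Qed.

Lemma su2_dist_eq0 g h : su2_dist g h = 0 <-> g = h.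
Proof.
split=> [|->]; last first.
  by rewrite /su2_dist; do 2![apply: big1 => ? _]; rewrite !subrr expr0n addr0.
move=> /eqP; rewrite psumr_eq0; last first.
  by move=> a _; apply: sumr_ge0 => ? _; rewrite addr_ge0 ?sqr_ge0.
move=> /allP E; apply/val_inj/matrixP => a b.
have := E a (mem_index_enum a); rewrite psumr_eq0; last first.
  by move=> ? _; rewrite addr_ge0 ?sqr_ge0.
move=> /allP /(_ b (mem_index_enum b)) /=.
rewrite paddr_eq0 ?sqr_ge0// !sqrf_eq0 !subr_eq0 => /andP[re im].
by apply/eqP; rewrite eq_complex re.
Qed.

Lemma su2_distE g h : su2_dist g h =
  complex.Re (\tr ((su2mx g - su2mx h) *m
    map_mx Num.conj (su2mx g - su2mx h)^T)).
Proof.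
rewrite /mxtrace raddf_sum /=; apply: eq_bigr => a _.
rewrite mxE raddf_sum /=; apply: eq_bigr => b _.
rewrite !mxE conjCE.
by case: (su2mx g a b) (su2mx h a b) => ? ? [? ?] /=; ring.
Qed.

(** In the trace form [su2_distE] the unitary factor cancels. This makes [bump] gauge invariant when
    it compares two components. *)
Lemma su2_dist_mulr g h k : su2_dist (SU2_mul g k) (SU2_mul h k) = su2_dist g h.
Proof.
rewrite !su2_distE /= -mulmxBl; congr (complex.Re (\tr _)).
have /andP[/unitarymxP ku _] := su2P k.
rewrite trmx_mul map_mxM mulmxA -(mulmxA _ (su2mx k)) ku mulmx1//.
Qed.

End su2_distance.

(** * Bump functions *)

Section bump.
Context {R : realType} {n : nat} (i0 : 'I_n) (r : option 'I_n).

(* Gauge-invariant bumps compare two components of x, the others compare one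
   component with the identity. *)
Definition ref (x : SU2n R n) : SU2 R := if r is Some i then x i else SU2_one.

(* su2_dist is at most 8, and it is 0 only on the diagonal. *)
Definition bump (x : SU2n R n) : R := 1 - su2_dist (x i0) (ref x) / 8.

Lemma bump_ge0 x : 0 <= bump x.
Proof. by rewrite subr_ge0 ler_pdivrMr// mul1r su2_dist_le8. Qed.

Lemma bump_le1 x : bump x <= 1.
Proof. by rewrite gerBl divr_ge0// su2_dist_ge0. Qed.

Lemma bump_one : bump SU2n_one = 1.
Proof.
rewrite /bump; have -> : ref SU2n_one = SU2_one by rewrite /ref; case: (r) => // i; rewrite ffunE.
by rewrite ffunE (su2_dist_eq0 _ _).2// mul0r subr0.
Qed.

Lemma bump_gauge x h : isSome r -> bump (SU2n_mul x (SU2n_diag h)) = bump x.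
Proof. by rewrite /bump /ref; case: (r) => // i _; rewrite !ffunE su2_dist_mulr. Qed.

Lemma bump_smooth m (t : R) : smooth_fun (fun x => t * bump x ^+ m).
Proof.
pose kre (X : 'M[R]_(n, 2 * 2 + 2 * 2)) a b : R :=
  if r is Some i then cre X i a b else complex.Re (SU2_one a b).
pose kim (X : 'M[R]_(n, 2 * 2 + 2 * 2)) a b : R :=
  if r is Some i then cim X i a b else complex.Im (SU2_one a b).
pose T X a b : R := (cre X i0 a b - kre X a b) ^+ 2 + (cim X i0 a b - kim X a b) ^+ 2.
pose F X : R := t * (1 + (- 8^-1) * \sum_(a < 2) \sum_(b < 2) T X a b) ^+ m.
have kreC k a b : is_Ck k (fun X => kre X a b).
  by rewrite /kre; case: (r) => [i|]; [exact: is_Ck_coord|exact: is_Ck_cst].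
have kimC k a b : is_Ck k (fun X => kim X a b).
  by rewrite /kim; case: (r) => [i|]; [exact: is_Ck_coord|exact: is_Ck_cst].
have TC k a b : is_Ck k (fun X => T X a b).
  have opp G : is_Ck k G -> is_Ck k (fun X : 'M[R]_(n, 2 * 2 + 2 * 2) => - G X : R).
    by move=> kG; have := is_Ck_scale (-1) kG; under eq_fun do rewrite mulN1r.
  apply: is_Ck_add; apply: is_Ck_exp; apply: is_Ck_add;
    try exact: is_Ck_coord; by apply: opp.
have sumC k (I : Type) (s : seq I) (G : I -> 'M[R]_(n, 2 * 2 + 2 * 2) -> R) :
    (forall i, is_Ck k (G i)) -> is_Ck k (fun X => \sum_(i <- s) G i X).
  move=> kG; elim: s => [|i s IH].
    by under eq_fun do rewrite big_nil; exact: is_Ck_cst.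
  by under eq_fun do rewrite big_cons; exact: is_Ck_add.
move=> x; exists F; split=> [k|].
  apply: is_Ck_scale; apply: is_Ck_exp; apply: is_Ck_add; first exact: is_Ck_cst.
  by apply: is_Ck_scale; apply: (sumC) => a; apply: (sumC) => b; exact: TC.
apply: (@filterE _ _ (@nbhs_filter (SU2n R n) x)) => y; rewrite /F /bump; congr (_ * (_ + _) ^+ _).
rewrite mulNr [in RHS]mulrC; congr (- (_ * _)).
apply: eq_bigr => a _; apply: eq_bigr => b _.
rewrite /T cre_coord cim_coord /kre /kim /ref.
by case: (r) => [i|] //; rewrite cre_coord cim_coord.
Qed.

Lemma bump_continuous : continuous bump.
Proof.
have := smooth_continuous (bump_smooth 1 1).
by under eq_fun do rewrite mul1r expr1.
Qed.

End bump.

(** * Concentration of the bumps on a null set *)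

Section bump_concentration.
Context {R : realType} {n : nat} (i0 : 'I_n) (r : option 'I_n).
Hypothesis ri0 : r != Some i0.
Variable mu : probability (SU2n R n) R.
Hypothesis mu_haar : is_haar mu.

Let shift (g : SU2 R) : SU2n R n := [ffun i => if i == i0 then g else SU2_one].

(** For g = 1 this is the set where [bump] equals 1; the other g give its left translates by
    [shift g]. *)
Let refset (g : SU2 R) : set (SU2n R n) :=
  [set x : SU2n R n | x i0 = SU2_mul g (ref r x)].

Lemma SU2_mul1 (g : SU2 R) : SU2_mul SU2_one g = g.
Proof. by apply/val_inj; rewrite /= mul1mx. Qed.

Lemma entry_continuous i a b :
  continuous (fun x : SU2n R n => complex.Re (x i a b)) /\
  continuous (fun x : SU2n R n => complex.Im (x i a b)).
Proof.
split.
- have -> : (fun x : SU2n R n => complex.Re (x i a b)) =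
      (fun X => cre X i a b) \o @SU2n_coord R n.
    by apply/funext => x /=; rewrite cre_coord.
  move=> x; apply: continuous_comp; first exact: initial_continuous.
  exact: coord_continuous.
- have -> : (fun x : SU2n R n => complex.Im (x i a b)) =
      (fun X => cim X i a b) \o @SU2n_coord R n.
    by apply/funext => x /=; rewrite cim_coord.
  move=> x; apply: continuous_comp; first exact: initial_continuous.
  exact: coord_continuous.
Qed.

Lemma continuous_sumR (I : Type) (s : seq I) (F : I -> SU2n R n -> R) :
  (forall i, continuous (F i)) -> continuous (fun x => \sum_(i <- s) F i x : R).
Proof.
move=> cF; elim: s => [|i s IH].
  by under eq_fun do rewrite big_nil; exact: continuous_cstR.
by under eq_fun do rewrite big_cons; exact: continuous_addR.
Qed.

Lemma refset_measurable g : measurable (refset g).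
Proof.
have cref a b : continuous (fun x : SU2n R n => complex.Re (ref r x a b)) /\
    continuous (fun x : SU2n R n => complex.Im (ref r x a b)).
  rewrite /ref; case: (r) => [i|]; first exact: entry_continuous.
  by split; exact: continuous_cstR.
have cprod a b :
    continuous (fun x : SU2n R n => complex.Re (SU2_mul g (ref r x) a b)) /\
    continuous (fun x : SU2n R n => complex.Im (SU2_mul g (ref r x) a b)).
  split.
  - have -> : (fun x : SU2n R n => complex.Re (SU2_mul g (ref r x) a b)) = fun x =>
        \sum_(c < 2) (complex.Re (g a c) * complex.Re (ref r x c b) +
          - (complex.Im (g a c) * complex.Im (ref r x c b))).
      apply/funext => x; rewrite mxE raddf_sum; apply: eq_bigr => c _.
      by case: (su2mx g a c) (su2mx (ref r x) c b) => ? ? [? ?].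
    apply: continuous_sumR => c; apply: continuous_addR.
      by apply: continuous_mulR; [exact: continuous_cstR|have [] := cref c b].
    apply: continuous_oppR.
    by apply: continuous_mulR; [exact: continuous_cstR|have [] := cref c b].
  - have -> : (fun x : SU2n R n => complex.Im (SU2_mul g (ref r x) a b)) = fun x =>
        \sum_(c < 2) (complex.Re (g a c) * complex.Im (ref r x c b) +
          complex.Im (g a c) * complex.Re (ref r x c b)).
      apply/funext => x; rewrite mxE raddf_sum; apply: eq_bigr => c _.
      by case: (su2mx g a c) (su2mx (ref r x) c b) => ? ? [? ?].
    apply: continuous_sumR => c; apply: continuous_addR.
      by apply: continuous_mulR; [exact: continuous_cstR|have [] := cref c b].
    by apply: continuous_mulR; [exact: continuous_cstR|have [] := cref c b].
have cds : continuous (fun x : SU2n R n => su2_dist (x i0) (SU2_mul g (ref r x))).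
  apply: continuous_sumR => a; apply: continuous_sumR => b.
  have [c1 c2] := entry_continuous i0 a b; have [c3 c4] := cprod a b.
  apply: continuous_addR; apply: continuous_expnR; apply: continuous_addR => //;
    exact: continuous_oppR.
have cl : closed (refset g).
  have -> : refset g = (fun x : SU2n R n => su2_dist (x i0) (SU2_mul g (ref r x))) @^-1` [set 0].
    by apply/seteqP; split=> x /su2_dist_eq0.
  by move/continuous_closedP : cds; apply; exact: closed_eq.
rewrite -[refset g]setCK; apply: measurableC; apply: open_measurable_SU2n.
exact: closed_openC.
Qed.

(** The translation changes component [i0] only, and by [ri0] the reference is not that component,
    so [ref] is unaffected. *)
Lemma refset_shift g :
  [set SU2n_mul (shift g) y | y in refset SU2_one] = refset g.
Proof.
have ref_ext (x y : SU2n R n) : (forall i, i != i0 -> x i = y i) ->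
    ref r x = ref r y.
  move: ri0; rewrite /ref; case: (r) => // i ii0; apply.
  by apply: contra_neq ii0 => ->.
apply/seteqP; split=> [_ [y yE <-]|x xE].
  rewrite /refset /= !ffunE eqxx yE SU2_mul1; congr SU2_mul.
  by apply: ref_ext => i /negbTE ii0; rewrite !ffunE ii0 SU2_mul1.
pose y : SU2n R n := [ffun i => if i == i0 then ref r x else x i].
exists y.
  rewrite /refset /= SU2_mul1 {1}/y ffunE eqxx.
  by apply: ref_ext => i /negbTE ii0; rewrite ffunE ii0.
apply/ffunP => i; rewrite !ffunE; have [->|_] := eqVneq i i0; first by rewrite xE.
exact: SU2_mul1.
Qed.

(* The left translates of the set by the rotations rot k are pairwise disjoint
   and have the same measure. *)
Lemma refset_null : mu (refset SU2_one) = 0%E.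
Proof.
have fin : mu (refset SU2_one) \is a fin_num.
  exact: fin_num_measure (refset_measurable _).
rewrite -(fineK fin); set m := fine _; congr EFin.
have m0 : 0 <= m by rewrite fine_ge0.
apply/eqP; rewrite eq_le m0 andbT.
(* N+1 disjoint sets of mass m fit into a probability space, so m is at most 1/(N+1). *)
apply: (cvg0_le (@cvg0_inv R)) => N; rewrite add0r /=.
have triv : trivIset setT (fun k => refset (rot k)).
  move=> k l _ _ [x [/= xk xl]]; apply: (@rot_inj R).
  by apply: SU2_mul_cancel (ref r x) _; rewrite -xk -xl.
have mE k : mu (refset (rot k)) = m%:E.
  by rewrite -refset_shift mu_haar ?fineK//; exact: refset_measurable.
have E : mu (\big[setU/set0]_(i < N.+1) refset (rot i)) = (m *+ N.+1)%:E.
  apply: etrans (@measure_bigsetU _ _ _ mu (fun k => refset (rot k))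
    (fun k => refset_measurable _) triv N.+1) _.
  rewrite (eq_bigr (fun=> m%:E)) => [|k _]; last exact: mE.
  by rewrite sumEFin sumr_const card_ord.
have : (mu (\big[setU/set0]_(i < N.+1) refset (rot i)) <= 1)%E.
  apply: probability_le1; apply: bigsetU_measurable => k _.
  exact: refset_measurable.
rewrite E lee_fin => h.
by rewrite -[leRHS]div1r ler_pdivlMr ?ltr0n// mulr_natr.
Qed.

Lemma bump_lt1 x : ~ refset SU2_one x -> bump i0 r x < 1.
Proof.
move=> xN; rewrite lt_neqAle bump_le1 andbT; apply: contra_notN xN => /eqP.
rewrite /bump => E; have /su2_dist_eq0 xE : su2_dist (x i0) (ref r x) = 0 by lra.
by rewrite /refset /= SU2_mul1.
Qed.

(** Dominated convergence with majorant 1: off a null set [bump] lies in [0,1) and its powers tend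
    to 0, whereas at the identity they stay 1. *)
Lemma bump_cvg0 :
  (fun m => \int[mu]_x ((bump i0 r x ^+ m) ^+ 2)) @ \oo --> (0 : R).
Proof.
have cb m : continuous (fun x => (bump i0 r x ^+ m) ^+ 2 : R).
  by do 2!apply: continuous_expnR; exact: bump_continuous.
have ib m := continuous_integrable_SU2n mu measurableT (cb m).
have refN0 : mu.-negligible (refset SU2_one).
  by apply/negligibleP; [exact: refset_measurable|exact: refset_null].
have [|||_ _] := @dominated_convergence _ _ _ mu setT measurableT
  _ (fun=> 0%E) (fun=> 1%E) (fun m => measurable_int mu (ib m)) (measurable_cst _).
- apply: negligibleS refN0 => x /= h; apply: contrapT => /bump_lt1 b1.
  apply: h => _; apply: cvg_EFin; first by apply: nearW.
  have c1 : (fun m => bump i0 r x ^+ m) @ \oo --> (0 : R).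
    by apply: cvg_expr; rewrite ger0_norm ?bump_ge0.
  apply: cvg0_squeeze c1 _ => m; rewrite sqr_ge0 /= expr2.
  by rewrite ler_piMl ?exprn_ge0 ?bump_ge0// exprn_ile1 ?bump_ge0 ?bump_le1.
- have i1 : mu.-integrable setT (EFin \o (fun _ : SU2n R n => 1 : R)).
    by apply: continuous_integrable_SU2n => //; exact: continuous_cstR.
  exact: i1.
- apply: aeW => x m _; rewrite lee_fin ger0_norm ?sqr_ge0//.
  by rewrite !exprn_ile1 ?exprn_ge0 ?bump_ge0 ?bump_le1.
by rewrite integral0 => /fine_cvgP [_].
Qed.

End bump_concentration.

(** * Bump fields and the two claims about the states *)

Section bump_field.
Context {R : realType} {n : nat} (S : field_space).
Variables (i0 : 'I_n) (r : option 'I_n).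
Hypothesis Sr : S = gauge_invariant -> isSome r.

Lemma bump_field_subproof m (t : R) :
  (fun x => (t * bump i0 r x ^+ m)%:C%C : Rcomplex R) \in @smooth_fields R n S.
Proof.
apply/asboolP; split; [exact: bump_smooth|exact: smooth_fun_cst|].
by move: Sr; case: (S) => // rS x h; rewrite bump_gauge// rS.
Qed.

Definition bump_field m t : smooth_field R n S := MkField (bump_field_subproof m t).

Lemma bump_field_one m t : complex.Re (bump_field m t SU2n_one) = t.
Proof. by rewrite /= bump_one expr1n mulr1. Qed.

Lemma bump_field_cvg0 (mu : probability (SU2n R n) R) (t : R) :
  is_haar mu -> r != Some i0 ->
  (fun m => rq (@L2form R n S mu) (bump_field m t)) @ \oo --> 0.
Proof.
move=> mu_haar ri0; have h := cvg0Z (t ^+ 2) (bump_cvg0 ri0 mu_haar).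
apply/cvgrPdist_lt => e e0.
have /cvgrPdist_lt /(_ _ (exprn_gt0 2 e0)) [N _ hN] := h.
exists N => // m /hN /=; rewrite !sub0r !normrN (ger0_norm (rq_ge0 _ _)) => hm.
rewrite -(@ltr_pXn2r _ 2) ?nnegrE ?rq_ge0 ?(ltW e0)//.
apply: le_lt_trans (le_lt_trans (ler_norm _) hm).
rewrite rq_sqr L2formE -[leRHS]addr0 -(Rintegral_probability_cst mu 0) -Rintegral_lin.
- rewrite le_eqVlt; apply/orP; left; apply/eqP; congr (Rintegral _ _ _).
  by apply/funext => x; rewrite /fre /fim /=; ring.
- by do 2!apply: continuous_expnR; exact: bump_continuous.
- exact: continuous_cstR.
Qed.

End bump_field.

Theorem mainTheorem2 (R : realType) (n : nat) (S : field_space)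
    (mu : probability (SU2n R n) R) (mu_haar : is_haar mu)
    (A : weyl_algebra (@L2symp R n S mu))
    (U : nat -> set (SU2n R n))
    (U_open : forall k, open (U k))
    (U_decr : forall k, U k.+1 `<=` U k)
    (U_cap : \bigcap_k U k = [set SU2n_one])
    (omega_F : state A)
    (omega_FE : forall f : smooth_field R n S, omega_F (weyl f) = fock_value mu f)
    (omega : nat -> state A)
    (omegaE : forall k (f : smooth_field R n S), omega k (weyl f) =
       omega_F (weyl f) * expi (Num.sqrt 2 * complex.Re (Cmean mu (U k) f)))
    (omega_D : state A)
    (omega_DE : forall f : smooth_field R n S, omega_D (weyl f) =
       omega_F (weyl f) * expi (Num.sqrt 2 * complex.Re (f SU2n_one))) :
  (forall k, equivalent_states (omega k) omega_F) /\
  ((0 < n)%N -> (S = gauge_invariant -> (1 < n)%N) ->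
   ~ equivalent_states omega_D omega_F).
Proof.
split=> [k|n0 n1].
  have mU : measurable (U k) by exact: open_measurable_SU2n.
  have [h [e [e0 hC hl]]] := @mean_approx _ _ S mu (U k) mU.
  exact: (translate_equivalent (L2symp_Dl mu) (L2symp_anti mu)
    (L2symp_le mu) omega_FE e0 hC hl (omegaE k)).
pose i0 := Ordinal n0.
(* Gauge-invariant bumps need a second component as reference, hence n > 1. For n = 0, or n = 1 with
   gauge invariance, all fields are constant and evaluation at the identity is L^2-bounded. *)
have [r [ri0 Sr]] : exists r : option 'I_n,
    r != Some i0 /\ (S = gauge_invariant -> isSome r).
  case: (S) n1 => [_|n1]; first by exists None.
  by exists (Some (Ordinal (n1 erefl))).
have sq2 : Num.sqrt 2 != 0 :> R by rewrite sqrtr_eq0 -ltNge.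
(* Then the phase is exp(i pi) = -1 for every exponent m, since all bumps equal 1 at the
   identity. *)
pose t : R := pi / Num.sqrt 2.
have bump0 := bump_field_cvg0 Sr t mu_haar ri0.
apply: (@sharp_inequivalent _ _ _ (@L2form R n S mu) A (@L2symp_Dl R n S mu)
  (@L2symp_anti R n S mu) (@L2symp_le R n S mu) omega_F omega_FE omega_D
  (fun f => Num.sqrt 2 * complex.Re (f SU2n_one)) _ bump0 _ omega_DE) => m.
rewrite bump_field_one /t mulrC divfK// /expi cospi sinpi.
by apply/eqP; rewrite eq_complex /= oppr0 !eqxx.
Qed.
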